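(* For every $n\ge2$, $\mu(S_3^n)=3^{n-2}+3$. Moreover, for $n\ge4$: if $X$ is a mutual-visibility set of $S_3^n$ with $|X|=3^{n-2}+3$, then $|X\cap V(iS_3^{n-1})|=3^{n-3}+1$ for every $i\in\{0,1,2\}$; and for every mutual-visibility set $X$ of $S_3^n$ and all distinct $i,j\in\{0,1,2\}$, $|X\cap(V(iS_3^{n-1})\cup V(jS_3^{n-1}))|\le 2\cdot3^{n-3}+4$.
   Context: For $p\ge3$, $n\ge1$, the Sierpiński graph $S_p^n$ has vertex set $\{0,1,\dots,p-1\}^n$, a vertex written $i_1\cdots i_n$; vertices $i_1\cdots i_n$ and $j_1\cdots j_n$ are adjacent iff there is $h$ with $i_t=j_t$ for $t<h$, $i_h\ne j_h$, and $i_t=j_h$, $j_t=i_h$ for $t>h$. For $i\in\{0,\dots,p-1\}$, $iS_p^{n-1}$ denotes the subgraph of $S_p^n$ induced by all vertices whose first coordinate is $i$. For $X\subseteq V(G)$, $u,v$ are $X$-visible if some shortest $u,v$-path $P$ has $V(P)\cap X\subseteq\{u,v\}$; $X$ is a mutual-visibility set if every two vertices of $X$ are $X$-visible; $\mu(G)$ is the maximum size of a mutual-visibility set. *)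

(* Defs.v *)
From mathcomp Require Import all_boot.
Set Implicit Arguments. Unset Strict Implicit. Unset Printing Implicit Defensive.

Section Visibility.
Variables (T : finType) (e : rel T).

Definition walk (u : T) (p : seq T) (v : T) : bool := path e u p && (last u p == v).

Definition shortest_path (u : T) (p : seq T) (v : T) : Prop :=
  walk u p v /\ forall q : seq T, walk u q v -> size p <= size q.

Definition visible (X : {set T}) (u v : T) : Prop :=
  exists p : seq T, shortest_path u p v /\
    forall x, x \in u :: p -> x \in X -> (x == u) || (x == v).

Definition mutual_visibility_set (X : {set T}) : Prop :=
  forall u v, u \in X -> v \in X -> visible X u v.

Definition is_mu (k : nat) : Prop :=
  (exists X : {set T}, mutual_visibility_set X /\ #|X| = k) /\
  (forall X : {set T}, mutual_visibility_set X -> #|X| <= k).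
End Visibility.

(* Vertices of S_p^n: words i_1...i_n, coordinate t+1 stored at index t : 'I_n *)
Definition SV (p n : nat) := {ffun 'I_n -> 'I_p}.

Definition sadj (p n : nat) : rel (SV p n) := fun u v =>
  [exists h : 'I_n,
     (u h != v h) &&
     [forall t : 'I_n, ((t < h) ==> (u t == v t)) &&
                       ((h < t) ==> ((u t == v h) && (v t == u h)))]].

Definition block (p n : nat) (i : 'I_p) : {set SV p n} :=
  [set u : SV p n | [exists h : 'I_n, (val h == 0) && (u h == i)]].

(* Main.v *)
(* Split S_3^n into its blocks 0S, 1S, 2S. If X is a mutual-visibility set meeting
   all three blocks and detours are ignored, then every element of a block must see
   the two corners leading to the other blocks. Counting recursively, with
   B = 3^(n-2), a mutual-visibility set of S_3^n all of whose elements see 0, 1 or 2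
   prescribed corners has at most B+3, B+2, B+1 elements, and at most B elements if
   they see all three corners and two sides of the triangle are free of X. These
   four bounds imply each other from n-1 to n: three blocks seeing two corners
   give 3(B/3+1) = B+3, and so on.
   A detour from block i to block j through k forces all of X in block j to be
   closer to corner k than to corner i, so block j then loses at least as much as
   block i gains. The bounds at n = 2 and the equality case n = 4 rest on a search
   through the mutual-visibility sets of S_3^2 and S_3^3. *)
Require Import Defs.
From mathcomp Require Import all_boot zify.
Set Implicit Arguments. Unset Strict Implicit. Unset Printing Implicit Defensive.

(** * Words over three digits and recursive visibility *)

Notation word := (seq 'I_3).

Definition o0 : 'I_3 := @Ordinal 3 0 isT.
Definition o1 : 'I_3 := @Ordinal 3 1 isT.
Definition o2 : 'I_3 := @Ordinal 3 2 isT.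

Lemma I3_ind (P : 'I_3 -> Prop) : P o0 -> P o1 -> P o2 -> forall i, P i.
Proof.
move=> P0 P1 P2 [[|[|[|//]]] lti].
- by rewrite (_ : Ordinal lti = o0) //; apply: val_inj.
- by rewrite (_ : Ordinal lti = o1) //; apply: val_inj.
- by rewrite (_ : Ordinal lti = o2) //; apply: val_inj.
Qed.

(* For [i != j], the digit different from both. *)
Definition third (i j : 'I_3) : 'I_3 :=
  match val i + val j with 1 => o2 | 2 => o1 | _ => o0 end.

Definition distinct3 (i j k : 'I_3) := [&& i != j, i != k & j != k].

Lemma thirdE i j k : distinct3 i j k -> third i j = k.
Proof. by move: k; elim/I3_ind: i; elim/I3_ind: j; elim/I3_ind. Qed.

Lemma thirdP i j : i != j -> distinct3 i j (third i j).
Proof. by elim/I3_ind: i; elim/I3_ind: j. Qed.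

Lemma thirdC i j : third i j = third j i.
Proof. by rewrite /third addnC. Qed.

Lemma distinct3CA i j k : distinct3 i j k -> distinct3 j i k.
Proof. by case/and3P=> a b c; apply/and3P; split=> //; rewrite eq_sym. Qed.

Lemma distinct3AC i j k : distinct3 i j k -> distinct3 i k j.
Proof. by case/and3P=> a b c; apply/and3P; split=> //; rewrite eq_sym. Qed.

Lemma distinct3_cover i j k l : distinct3 i j k -> [|| l == i, l == j | l == k].
Proof. by elim/I3_ind: i; elim/I3_ind: j; elim/I3_ind: k; elim/I3_ind: l. Qed.

Definition slice (X : pred word) (i : 'I_3) : pred word := fun w => X (i :: w).

(* Distance from [u] to the extreme vertex [c...c]. *)
Fixpoint dc (u : word) (c : 'I_3) : nat :=
  if u is i :: u' then (i != c) * 2 ^ size u' + dc u' c else 0.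

(* [X] misses the geodesic from [i...i] to [c...c] in S_3^n, endpoints included. *)
Fixpoint sidefree (n : nat) (X : pred word) (i c : 'I_3) : bool :=
  if n is m.+1 then sidefree m (slice X i) i c && sidefree m (slice X c) i c
  else ~~ X [::].

(* [X] misses the unique geodesic from [u] to [c...c], except possibly at [u]. *)
Fixpoint sees (X : pred word) (u : word) (c : 'I_3) : bool :=
  if u is i :: u' then
    sees (slice X i) u' c && ((i == c) || sidefree (size u') (slice X c) i c)
  else true.

(* Two vertices in different blocks [i] and [j] are joined by at most two
   geodesics: the direct one uses the edge between the blocks, the detour
   crosses the third block [k] along a side. *)
Fixpoint vis (X : pred word) (u v : word) : bool :=
  match u, v with
  | i :: u', j :: v' =>
    if i == j then vis (slice X i) u' v' else
    let k := third i j in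
    let dir := dc u' j + dc v' i in
    let det := dc u' k + 2 ^ size u' + dc v' k in
    [&& dir <= det, sees (slice X i) u' j & sees (slice X j) v' i]
    || [&& det <= dir, sees (slice X i) u' k, sees (slice X j) v' k
         & sidefree (size u') (slice X k) i j]
  | _, _ => true
  end.

Fixpoint words (n : nat) : seq word :=
  if n is m.+1 then
    [seq o0 :: w | w <- words m] ++ [seq o1 :: w | w <- words m]
    ++ [seq o2 :: w | w <- words m]
  else [:: [::]].

Lemma mem_words n w : (w \in words n) = (size w == n).
Proof.
elim: n w => [|n IH] [|i w] //=.
  by rewrite !mem_cat; apply/negP => /or3P[] /mapP[].
rewrite !mem_cat eqSS -IH; apply/or3P/idP.
  by case=> /mapP[v vn [_ ->]].
move=> wn; have [/eqP->|/eqP->|/eqP->] := or3P (@distinct3_cover o0 o1 o2 i isT).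
- by apply: Or31; apply: map_f.
- by apply: Or32; apply: map_f.
- by apply: Or33; apply: map_f.
Qed.

Lemma words_uniq n : uniq (words n).
Proof.
elim: n => //= n IH.
rewrite !cat_uniq !map_inj_uniq ?IH //; try by move=> x y [].
apply/and3P; split=> //; last (apply/and3P; split=> //); apply/hasPn => w.
  by rewrite mem_cat => /orP[] /mapP[v _ ->]; apply/negP => /mapP[? _].
by case/mapP=> v _ ->; apply/negP => /mapP[? _].
Qed.

Definition cnt n (X : pred word) := count X (words n).

Lemma cntS n X i j k : distinct3 i j k ->
  cnt n.+1 X = cnt n (slice X i) + cnt n (slice X j) + cnt n (slice X k).
Proof.
have -> : cnt n.+1 X = cnt n (slice X o0) + cnt n (slice X o1) + cnt n (slice X o2).
  by rewrite /cnt /= !count_cat !count_map addnA.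
move: k; elim/I3_ind: i; elim/I3_ind: j; elim/I3_ind => // _; lia.
Qed.

Definition all_in n (X P : pred word) := all (fun u => X u ==> P u) (words n).

Lemma all_inP n (X P : pred word) :
  reflect (forall u, size u = n -> X u -> P u) (all_in n X P).
Proof.
apply: (iffP allP) => [h u sz Xu|h u].
  by apply: (implyP (h u _)) => //; rewrite mem_words sz.
by rewrite mem_words => /eqP sz; apply/implyP; apply: h.
Qed.

Lemma all_inPn n (X P : pred word) :
  reflect (exists u, [/\ size u = n, X u & ~~ P u]) (~~ all_in n X P).
Proof.
apply: (iffP allPn) => [[u]|[u [sz Xu nPu]]].
  by rewrite mem_words negb_imply => /eqP sz /andP[Xu nPu]; exists u.
by exists u; rewrite ?mem_words ?sz ?negb_imply ?Xu.
Qed.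

Definition mutvis n X := all_in n X (fun u => all_in n X (vis X u)).

Definition allsees n X c := all_in n X (fun u => sees X u c).

Lemma mutvis_slice n X i : mutvis n.+1 X -> mutvis n (slice X i).
Proof.
move/all_inP=> h; apply/all_inP=> u su Xu; apply/all_inP => v sv Xv.
have := all_inP _ _ _ (h (i :: u) _ Xu) (i :: v); rewrite /= su sv eqxx.
by apply.
Qed.

Section Monotone.
Implicit Types X Y : pred word.

Lemma slice_subpred X Y i : subpred X Y -> subpred (slice X i) (slice Y i).
Proof. by move=> h w; apply: h. Qed.

Lemma sidefree_subpred n X Y i c : subpred X Y -> sidefree n Y i c -> sidefree n X i c.
Proof.
elim: n X Y => [|n IH] X Y XY /=; first by apply: contra; apply: XY.
by case/andP=> h1 h2; rewrite !(IH _ _ (slice_subpred XY)).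
Qed.

Lemma sees_subpred X Y u c : subpred X Y -> sees Y u c -> sees X u c.
Proof.
elim: u X Y => //= i u IH X Y XY /andP[h1 /orP h2].
rewrite (IH _ _ (slice_subpred XY)) //=; case: h2 => [->//|h2].
by rewrite (sidefree_subpred (slice_subpred XY)) ?orbT.
Qed.

Lemma vis_subpred X Y u v : subpred X Y -> vis Y u v -> vis X u v.
Proof.
elim: u v X Y => [|i u IH] [|j v] //= X Y XY.
case: eqP => [_|_]; first by apply: IH; apply: slice_subpred.
case/orP => [/and3P[-> h1 h2]|/and4P[-> h1 h2 h3]].
  by rewrite (sees_subpred (slice_subpred XY) h1) (sees_subpred (slice_subpred XY) h2).
rewrite (sees_subpred (slice_subpred XY) h1) (sees_subpred (slice_subpred XY) h2).
by rewrite (sidefree_subpred (slice_subpred XY) h3) orbT.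
Qed.

(** Deleting elements only removes obstacles. This heredity lets the search prune partial sets and
    lets a corner be deleted in [double_fail]. *)
Lemma mutvis_subpred n X Y : subpred X Y -> mutvis n Y -> mutvis n X.
Proof.
move=> XY /all_inP h; apply/all_inP=> u su Xu; apply/all_inP=> v sv Xv.
by apply: (vis_subpred XY); apply: (all_inP _ _ _ (h u su _)) => //; apply: XY.
Qed.

End Monotone.

(** * Exhaustive search *)

Section Search.
Variables (T : eqType) (Q : seq T -> bool).

(** Depth-first search for [k] further elements, taken from [l] in order, with [Q] tested on every
    partial list. The conditional, unlike [&&], keeps the recursive call unevaluated after a failed
    test under call-by-value computation. *)
Fixpoint search (k : nat) (acc l : seq T) : bool :=
  if k is k'.+1 then
    (fix loop l := if l is a :: l' then
        (if Q (a :: acc) then search k' (a :: acc) l' else false) || loop l'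
      else false) l
  else true.

Lemma search_complete (X : pred T) k acc s l :
  (forall t, all X t -> Q t) -> all X acc -> all X s -> subseq s l ->
  k <= size s -> search k acc l.
Proof.
move=> XQ; elim: k acc s l => //= k IH acc s l Xacc.
elim: l s => [|a l IHl] [|b s] //= /andP[Xb Xs].
case: eqP => [<-|_] sub_s ks; last by rewrite (IHl (b :: s)) ?orbT //= Xb.
by rewrite XQ /= ?Xb // (IH _ s) //= Xb.
Qed.
End Search.

Definition mutvis_seq (s : seq word) := all (fun u => all (fun v => vis (mem s) u v) s) s.

(** [C] also receives the partial set, because a constraint such as [sees] depends on it; it is
    tested before the quadratic check of all pairs. *)
Definition no_mutvis n (P : pred word) (C : pred word -> pred word) k :=
  ~~ search (fun s => if all (C (mem s)) s then mutvis_seq s else false) k [::]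
       (filter P (words n)).

(** The condition on [C] is asked for every subset [Y] of [X], since the search tests partial
    sets. *)
Lemma cnt_search n (P : pred word) (C : pred word -> pred word) k X :
  no_mutvis n P C k.+1 -> mutvis n X -> all_in n X P ->
  (forall Y u, subpred Y X -> size u = n -> X u -> C Y u) ->
  cnt n X <= k.
Proof.
move=> /negP nos mX XP XC; rewrite leqNgt; apply/negP => ltk; apply: nos.
(* [X] is arbitrary on words of other lengths, so it is first cut down to [words n]. *)
apply: (@search_complete _ _ [predI X & mem (words n)] _ _ [seq x <- words n | X x && P x]) => //.
- move=> t /allP Xt.
  have tX : subpred (mem t) X by move=> x /Xt /andP[].
  have tn x : x \in t -> size x = n by move/Xt => /andP[_] /=; rewrite mem_words => /eqP.
  have -> : all (C (mem t)) t by apply/allP=> u ut; apply: XC; [exact: tX|exact: tn|exact: tX].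
  apply/allP=> u ut; apply/allP=> v vt.
  by apply: (all_inP _ _ _ (all_inP _ _ _ (mutvis_subpred tX mX) u _ _)); do ?exact: tn.
- by apply/allP=> u; rewrite mem_filter => /andP[/andP[Xu _] uw]; apply/andP.
- suff -> : [seq x <- words n | X x && P x] = filter X (filter P (words n)) by exact: filter_subseq.
  by rewrite -filter_predI.
- suff -> : [seq x <- words n | X x && P x] = filter X (words n) by rewrite size_filter.
  by apply: eq_in_filter => u; rewrite mem_words => /eqP su; case Xu: (X u) => //=; apply: (all_inP _ _ _ XP).
Qed.

Definition all_distinct (P : 'I_3 -> 'I_3 -> 'I_3 -> bool) :=
 [&& P o0 o1 o2, P o0 o2 o1, P o1 o0 o2, P o1 o2 o0, P o2 o0 o1 & P o2 o1 o0].

Lemma all_distinctP P : all_distinct P -> forall i j k, distinct3 i j k -> P i j k.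
Proof.
case/and5P=> h1 h2 h3 h4 /andP[h5 h6] i j k.
by move: k; elim/I3_ind: i; elim/I3_ind: j; elim/I3_ind.
Qed.

(** The searches on words of length 2 give the fields of [bounds] at [B = 1]; the size excluded is
    one more than the bound. *)
Lemma search_MU : no_mutvis 2 predT (fun _ => predT) 5.
Proof. by vm_cast_no_check (erefl true). Qed.

Lemma search_F :
  all_distinct (fun i _ _ => no_mutvis 2 predT (fun Y u => sees Y u i) 4).
Proof. by vm_cast_no_check (erefl true). Qed.

Lemma search_G : all_distinct (fun i j _ =>
  no_mutvis 2 predT (fun Y u => sees Y u i && sees Y u j) 3).
Proof. by vm_cast_no_check (erefl true). Qed.

Lemma search_H : all_distinct (fun i j k =>
  no_mutvis 2 predT (fun Y u =>
    [&& sees Y u i, sees Y u j, sees Y u k, sidefree 2 Y i j & sidefree 2 Y i k]) 2).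
Proof. by vm_cast_no_check (erefl true). Qed.

Lemma search_E1 : all_distinct (fun i _ k =>
  no_mutvis 2 (fun v => dc v k < dc v i) (fun Y u => sees Y u k) 3).
Proof. by vm_cast_no_check (erefl true). Qed.

Lemma search_E2 : all_distinct (fun i _ k =>
  no_mutvis 2 (fun v => dc v k + 2 <= dc v i) (fun Y u => sees Y u k) 2).
Proof. by vm_cast_no_check (erefl true). Qed.

Lemma search_E4 : all_distinct (fun i _ k =>
  no_mutvis 3 (fun v => dc v k + 4 <= dc v i) (fun Y u => sees Y u k) 3).
Proof. by vm_cast_no_check (erefl true). Qed.

(** The constraints on block [i] of an extremal set of S_3^4 with a strong failure: a corner may go
    unseen only from vertices nearer to the other one by at least 5. *)
Lemma search_far : all_distinct (fun _ j k =>
  no_mutvis 3 predT (fun Y u =>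
    (sees Y u j || sees Y u k && (dc u k + 5 <= dc u j))
    && (sees Y u k || sees Y u j && (dc u j + 5 <= dc u k))) 5).
Proof. by vm_cast_no_check (erefl true). Qed.

(** * Corner distances, sides and counting *)

Lemma visE X i j k u v : distinct3 i j k ->
  vis X (i :: u) (j :: v) =
    [&& dc u j + dc v i <= dc u k + 2 ^ size u + dc v k,
        sees (slice X i) u j & sees (slice X j) v i]
    || [&& dc u k + 2 ^ size u + dc v k <= dc u j + dc v i,
         sees (slice X i) u k, sees (slice X j) v k & sidefree (size u) (slice X k) i j].
Proof. by move=> d /=; rewrite (thirdE d); case/and3P: d => /negbTE->. Qed.

Lemma dc_lt u c : dc u c < 2 ^ size u.
Proof. elim: u => //= i u IH; rewrite expnS; case: (i == c) => /=; lia. Qed.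

Lemma dc0 u c : dc u c = 0 -> u = nseq (size u) c.
Proof.
elim: u => //= i u IH; case: eqP => [->|_] /=; first by rewrite mul0n => /IH {1}->.
by move/eqP; rewrite mul1n addn_eq0 expn_eq0.
Qed.

Lemma sidefreeC n X i c : sidefree n X i c = sidefree n X c i.
Proof. by elim: n X => //= n IH X; rewrite andbC !(IH _). Qed.

Lemma sidefree_end n X i c : sidefree n X i c -> ~~ X (nseq n c).
Proof. by elim: n X => //= n IH X /andP[_ /IH]. Qed.

(** A geodesic towards the corner ends there, so an occupied corner hides itself from every other
    vertex. *)
Lemma sees_corner X u c : sees X u c -> X (nseq (size u) c) -> u = nseq (size u) c.
Proof.
elim: u X => //= i u IH X; case: eqP => [->|_] /= /andP[su side] Xc.
  by rewrite {1}(IH _ su Xc).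
by have /negP[] := sidefree_end side.
Qed.

Lemma cnt_exists n X : 0 < cnt n X -> exists u, size u = n /\ X u.
Proof. by rewrite -has_count => /hasP[u]; rewrite mem_words => /eqP ? ?; exists u. Qed.

Lemma cnt_le_size n (X : pred word) s : (forall u, size u = n -> X u -> u \in s) -> cnt n X <= size s.
Proof.
move=> Xs; rewrite /cnt -size_filter; apply: uniq_leq_size.
  by rewrite filter_uniq // words_uniq.
by move=> u; rewrite mem_filter mem_words => /andP[Xu /eqP su]; apply: Xs.
Qed.

Lemma cnt_remove n X w : cnt n X <= (cnt n (fun u => X u && (u != w))).+1.
Proof.
have le1 : count_mem w (words n) <= 1 by rewrite count_uniq_mem ?words_uniq ?leq_b1.
suff le s : count X s <= count (fun u => X u && (u != w)) s + count_mem w s.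
  by have := le (words n); rewrite /cnt; lia.
by elim: s => //= a s IH; case: (X a); case: eqP => _ /=; lia.
Qed.

(** A vertex of block [i] reaches corner [c] along a whole side of block [c], so one occupied block
    already clears that side. *)
Lemma allsees_side n X i c : allsees n.+1 X c -> 0 < cnt n (slice X i) -> i != c ->
  sidefree n (slice X c) i c.
Proof.
move/all_inP=> h /cnt_exists[u [su Xu]] /negbTE ic.
by have := h (i :: u); rewrite /= su ic /= => /(_ erefl Xu) /andP[].
Qed.

Lemma allsees_block n X i c : allsees n.+1 X c -> allsees n (slice X i) c.
Proof.
by move/all_inP=> h; apply/all_inP=> u su Xu; have /andP[] := h (i :: u) (congr1 S su) Xu.
Qed.

(* With B = 3^(n-2), the size of a mutual-visibility set drops by one with each
   extra corner that all its elements must see. In [bE1] and [bE2] the elements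
   are moreover closer to corner [k] than to corner [i], which is what a missing
   direct path forces. *)
Record bounds (n B : nat) : Prop := Bounds {
  b_gt0 : 0 < B;
  bMU : forall X, mutvis n X -> cnt n X <= B + 3;
  bF : forall X c, mutvis n X -> allsees n X c -> cnt n X <= B + 2;
  bG : forall X c d, c != d -> mutvis n X -> allsees n X c -> allsees n X d ->
    cnt n X <= B + 1;
  bH : forall X i j k, distinct3 i j k -> mutvis n X ->
    allsees n X i -> allsees n X j -> allsees n X k ->
    sidefree n X i j -> sidefree n X i k -> cnt n X <= B;
  bE1 : forall X i k, i != k -> mutvis n X -> allsees n X k ->
    all_in n X (fun v => dc v k < dc v i) -> cnt n X <= B + 1;
  bE2 : forall X i k, i != k -> mutvis n X -> allsees n X k ->
    all_in n X (fun v => dc v k + 2 <= dc v i) -> cnt n X <= B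
}.

(** * The induction step *)

Section Block.
Variables (n B : nat) (X : pred word).
Hypotheses (hb : bounds n B) (mX : mutvis n.+1 X).

Local Notation c i := (cnt n (slice X i)).

Definition fails i j := ~~ allsees n (slice X i) j.

(* If some vertex of block [i] cannot see corner [j], then block [j] is closer to
   corner [k] than to corner [i]. A margin of at least 2 costs block [j] one element,
   which pays for the excess of block [i]; a margin of 1 at some vertex leaves the
   corner [k...k] of block [i] as the only vertex that can fail to see [j]. *)
Definition strong i j :=
  fails i j && all_in n (slice X j) (fun v => dc v (third i j) + 2 <= dc v i).

(** With the direct route blocked at [u], only the detour remains, and it cannot be longer than the
    direct route. Corner distances are below [2 ^ n], so each end must be strictly closer to corner
    [k]. *)
Lemma detour i j k u v : distinct3 i j k -> size u = n -> size v = n ->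
  slice X i u -> slice X j v -> ~~ sees (slice X i) u j ->
  [/\ sees (slice X i) u k, dc u k < dc u j, sees (slice X j) v k, dc v k < dc v i &
      dc u k + 2 ^ n + dc v k <= dc u j + dc v i].
Proof.
move=> d su sv Xu Xv /negbTE nsee.
have := all_inP _ _ _ (all_inP _ _ _ mX (i :: u) _ Xu) (j :: v) _ Xv.
rewrite (visE _ _ _ d) nsee andbF /= su sv => /(_ erefl erefl) /and4P[le ? ? _].
by have := dc_lt u j; have := dc_lt v i; rewrite su sv => ? ?; split=> //; lia.
Qed.

Lemma fails_E1 i j k : distinct3 i j k -> fails i j ->
  allsees n (slice X j) k /\ all_in n (slice X j) (fun v => dc v k < dc v i).
Proof.
move=> d /all_inPn[u [su Xu nu]].
by split; apply/all_inP=> v sv Xv; have [] := detour d su sv Xu Xv nu.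
Qed.

Lemma fails_cnt i j k : distinct3 i j k -> fails i j -> c j <= B + 1.
Proof.
move=> d /(fails_E1 d)[h1 h2]; have /and3P[_ ik _] := d.
exact: (bE1 hb ik (mutvis_slice _ mX)).
Qed.

Lemma strong_cnt i j k : distinct3 i j k -> strong i j -> c j <= B.
Proof.
move=> d /andP[/(fails_E1 d)[h1 _]]; rewrite (thirdE d) => h2; have /and3P[_ ik _] := d.
exact: (bE2 hb ik (mutvis_slice _ mX)).
Qed.

(** Failures from both sides would put each vertex of block [j] strictly closer to corner [k] than
    to corner [i], and conversely. *)
Lemma fails_excl i j k : distinct3 i j k -> 0 < c j -> fails i j -> ~~ fails k j.
Proof.
move=> d /cnt_exists[v [sv Xv]] /(fails_E1 d)[_ /all_inP/(_ v sv Xv)] lt1.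
apply/negP=> /(fails_E1 (k := i)) [].
  by apply/distinct3CA/distinct3AC/distinct3CA.
by move=> _ /all_inP/(_ v sv Xv); lia.
Qed.

Lemma weak_fail i j k : distinct3 i j k -> fails i j -> ~~ strong i j ->
  slice X i (nseq n k) /\
  forall u, size u = n -> slice X i u -> ~~ sees (slice X i) u j -> u = nseq n k.
Proof.
move=> d f; rewrite /strong f (thirdE d) /= => /all_inPn[v [sv Xv lev]].
have cor u : size u = n -> slice X i u -> ~~ sees (slice X i) u j -> u = nseq n k.
  move=> su Xu nu; have [_ _ _ lt1 le2] := detour d su sv Xu Xv nu.
  (* [v] has margin at most 1 and [dc u j] is at most [2 ^ n - 1], which leaves [dc u k = 0]. *)
  rewrite -{1}su; apply: dc0; have := dc_lt u j; rewrite su; lia.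
split=> //; have /all_inPn[u [su Xu nu]] := f.
by rewrite -(cor u).
Qed.

(** In the weak case corner [k...k] is occupied, yet the whole block sees it, so the block is that
    corner alone. *)
Lemma single_fail i j k : distinct3 i j k -> fails i j -> ~~ fails i k ->
  c i <= B + 1 + strong i j.
Proof.
move=> d f /negPn nf; have mXi : mutvis n (slice X i) by apply: mutvis_slice.
have [s|ns] := boolP (strong i j); first by have := bF hb mXi nf; rewrite /=; lia.
have [Xk _] := weak_fail d f ns.
suff : c i <= size [:: nseq n k] by rewrite /=; lia.
apply: cnt_le_size => u su Xu; rewrite inE -su.
by apply/eqP/sees_corner; [apply: (all_inP _ _ _ nf)|rewrite su].
Qed.

(** The weak failure puts corner [j...j] into the block, which hides it from all other elements.
    Once it is removed, every remaining vertex fails to see [j]: then [bE1] applies if that failure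
    is strong, and otherwise only [k...k] can remain. *)
Lemma double_fail i j k : distinct3 i j k -> 0 < c j -> fails i j -> fails i k ->
  ~~ strong i k -> c i <= B + 1 + strong i j.
Proof.
move=> d cj0 f1 f2 ns2; have mXi : mutvis n (slice X i) by apply: mutvis_slice.
have [Xj _] := weak_fail (distinct3AC d) f2 ns2.
pose Y := (fun u => slice X i u && (u != nseq n j)).
have YX : subpred Y (slice X i) by move=> u /andP[].
have nY u : size u = n -> Y u -> ~~ sees (slice X i) u j.
  move=> su /andP[/= Xu une]; apply/negP=> /sees_corner.
  by rewrite su => /(_ Xj) E; rewrite E eqxx in une.
have leY : c i <= (cnt n Y).+1 := cnt_remove n (slice X i) (nseq n j).
have [s1|ns1] := boolP (strong i j).
  suff : cnt n Y <= B + 1 by lia.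
  have [v [sv Xv]] := cnt_exists cj0.
  have Yd u su (Yu : Y u) := detour d su sv (YX _ Yu) Xv (nY u su Yu).
  have jk : j != k by case/and3P: d.
  apply: (bE1 hb jk (mutvis_subpred YX mXi)); apply/all_inP=> u su Yu; have [h1 h2 _ _ _] := Yd u su Yu => //.
  exact: sees_subpred h1.
suff : cnt n Y <= size [:: nseq n k] by have := b_gt0 hb; rewrite /=; lia.
apply: cnt_le_size => u su Yu; rewrite inE; apply/eqP.
by have [_] := weak_fail d f1 ns1; apply; rewrite ?nY ?YX.
Qed.

(* The charges cancel when the bounds of the three blocks are added. *)
Lemma block_bound i j k : distinct3 i j k -> 0 < c i -> 0 < c j -> 0 < c k ->
  c i + strong j i + strong k i <= B + 1 + strong i j + strong i k.
Proof.
move=> d ci0 cj0 ck0; have d' := distinct3AC d.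
have mXi : mutvis n (slice X i) by apply: mutvis_slice.
have jk : j != k by case/and3P: d.
have d1 : distinct3 j i k := distinct3CA d; have d2 : distinct3 k i j := distinct3CA d'.
(* A strong failure of block [j] towards block [i] costs block [i] one element, and [fails_excl]
   rules out a second charge from block [k]. *)
have [s1|ns1] := boolP (strong j i).
  have f1 : fails j i by case/andP: s1.
  have ns2 : strong k i = false by rewrite /strong (negbTE (fails_excl d1 ci0 f1)).
  by have := strong_cnt d1 s1; rewrite ns2; clear; lia.
have [s2|ns2] := boolP (strong k i).
  by have := strong_cnt d2 s2; clear; lia.
rewrite !addn0.
have [f1|/negPn nf1] := boolP (fails i j); have [f2|/negPn nf2] := boolP (fails i k).
- have [s2|s2] := boolP (strong i k); last first.
    by rewrite addn0; apply: double_fail d cj0 f1 f2 s2.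
  have [s1|s1] := boolP (strong i j); last first.
    by rewrite addn0; apply: leq_trans (double_fail d' ck0 f2 f1 s1) _; rewrite s2.
  (* Two strong failures raise the allowance to [B + 3], the general bound. *)
  by rewrite -!addnA; exact: (bMU hb mXi).
- apply: leq_trans (single_fail d f1 _) (leq_addr _ _).
  by rewrite /fails nf2.
- rewrite addnAC; apply: leq_trans (single_fail d' f2 _) (leq_addr _ _).
  by rewrite /fails nf1.
- by rewrite -addnA; apply: leq_trans (bG hb jk mXi nf1 nf2) (leq_addr _ _).
Qed.

(** A weak failure needs an occupied corner, which the free sides exclude. All failures are
    therefore strong, and seeing the own corner lowers the allowance from [B + 1] to [B]. *)
Lemma block_bound_free i j k : distinct3 i j k -> 0 < c j -> 0 < c k ->
  allsees n (slice X i) i -> sidefree n (slice X i) i j -> sidefree n (slice X i) i k ->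
  c i <= B + strong i j + strong i k.
Proof.
move=> d cj0 ck0 seei fj fk; have d' := distinct3AC d.
have [ij ik jk] := and3P d; have mXi : mutvis n (slice X i) by apply: mutvis_slice.
have str j' k' : distinct3 i j' k' -> sidefree n (slice X i) i k' -> fails i j' -> strong i j'.
  move=> dd fr f; apply/negPn/negP => ns; have [Xk _] := weak_fail dd f ns.
  by have := sidefree_end fr; rewrite Xk.
have [f1|/negPn nf1] := boolP (fails i j); have [f2|/negPn nf2] := boolP (fails i k).
- by rewrite (str j k) // (str k j) // -addnA; exact: (bF hb mXi seei).
- rewrite (str j k) //; apply: leq_trans (leq_addr _ _).
  exact: (bG hb ik mXi seei nf2).
- rewrite (str k j) // addnAC; apply: leq_trans (leq_addr _ _).
  exact: (bG hb ij mXi seei nf1).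
- by rewrite -addnA; apply: leq_trans (bH hb d mXi seei nf1 nf2 fj fk) (leq_addr _ _).
Qed.

(** Either some block fails to see the corner towards the other, giving [(B + 3) + (B + 1)], or
    neither does, giving [2 * (B + 2)]. *)
Lemma pair_bound i j : i != j -> c i + c j <= 2 * B + 4.
Proof.
move=> ij; have d := thirdP ij.
have mXi l : mutvis n (slice X l) by apply: mutvis_slice.
have := bMU hb (mXi i); have := bMU hb (mXi j); move=> uj ui.
have [f1|/negPn nf1] := boolP (fails i j).
  by have := fails_cnt d f1; lia.
have [f2|/negPn nf2] := boolP (fails j i).
  by have := fails_cnt (distinct3CA d) f2; lia.
by have := bF hb (mXi i) nf1; have := bF hb (mXi j) nf2; lia.
Qed.

End Block.

Lemma ex_distinct3 i : exists j k, distinct3 i j k.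
Proof.
by elim/I3_ind: i; [exists o1, o2|exists o0, o2|exists o0, o1].
Qed.

Lemma distinct3_third i k : i != k -> distinct3 i (third i k) k.
Proof. by move/thirdP/distinct3AC. Qed.

Lemma all_in_true n X : all_in n X predT.
Proof. exact/all_inP. Qed.

(** * Base case and passage to the next length *)

Lemma bounds2 : bounds 2 1.
Proof.
split=> // [X mX|X i mX sc|X i j ij mX sc sd|X i j k d mX si sj sk fj fk|X i k ik mX sk lt|X i k ik mX sk lt].
- exact: (cnt_search search_MU mX (all_in_true _ _)).
- have [j [k d]] := ex_distinct3 i.
  apply: (cnt_search (all_distinctP search_F d) mX (all_in_true _ _)) => Y u YX su Xu.
  exact: sees_subpred YX (all_inP _ _ _ sc u su Xu).
- apply: (cnt_search (all_distinctP search_G (thirdP ij)) mX (all_in_true _ _)) => Y u YX su Xu.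
  have see e : allsees 2 X e -> sees Y u e.
    by move/all_inP=> h; apply: sees_subpred YX (h u su Xu).
  by rewrite !see.
- apply: (cnt_search (all_distinctP search_H d) mX (all_in_true _ _)) => Y u YX su Xu.
  have see e : allsees 2 X e -> sees Y u e.
    by move/all_inP=> h; apply: sees_subpred YX (h u su Xu).
  by rewrite !see // !(sidefree_subpred YX).
- apply: (cnt_search (all_distinctP search_E1 (distinct3_third ik)) mX lt) => Y u YX su Xu.
  exact: sees_subpred YX (all_inP _ _ _ sk u su Xu).
- apply: (cnt_search (all_distinctP search_E2 (distinct3_third ik)) mX lt) => Y u YX su Xu.
  exact: sees_subpred YX (all_inP _ _ _ sk u su Xu).
Qed.

Section Step.
Variables (n B : nat) (X : pred word).
Hypotheses (hb : bounds n B) (mX : mutvis n.+1 X).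

Local Notation c i := (cnt n (slice X i)).

Lemma step_MU : cnt n.+1 X <= 3 * B + 3.
Proof.
have B_gt0 := b_gt0 hb.
rewrite (cntS _ _ (isT : distinct3 o0 o1 o2)).
(* These settle the case of an empty block: [2 * B + 4 <= 3 * B + 3] as [B] is positive. *)
have p01 := pair_bound hb mX (isT : o0 != o1).
have p02 := pair_bound hb mX (isT : o0 != o2).
have p12 := pair_bound hb mX (isT : o1 != o2).
have [c0|c0] := posnP (c o0); first by lia.
have [c1|c1] := posnP (c o1); first by lia.
have [c2|c2] := posnP (c o2); first by lia.
have := block_bound hb mX (isT : distinct3 o0 o1 o2) c0 c1 c2.
have := block_bound hb mX (isT : distinct3 o1 o0 o2) c1 c0 c2.
have := block_bound hb mX (isT : distinct3 o2 o0 o1) c2 c0 c1.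
lia.
Qed.

Lemma pair_F p q l : p != q -> l != q ->
  allsees n (slice X p) l -> allsees n (slice X q) l -> c p + c q <= 2 * B + 3.
Proof.
move=> pq lq sp sq; have mXl e : mutvis n (slice X e) by apply: mutvis_slice.
have := bF hb (mXl p) sp; have := bF hb (mXl q) sq => uq up.
have [f|/negPn nf] := boolP (fails n X p q).
  by have := fails_cnt hb mX (thirdP pq) f; lia.
by have := bG hb lq (mXl p) sp nf; lia.
Qed.

Lemma strong0 i j : allsees n (slice X i) j -> strong n X i j = false.
Proof. by rewrite /strong /fails => ->. Qed.

(** Block [i] contributes [B] by [block_bound_free] and the others [B + 1] each, up to cancelling
    charges; nothing is charged to block [i], whose corner all blocks see. *)
Lemma step_F i : allsees n.+1 X i -> cnt n.+1 X <= 3 * B + 2.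
Proof.
move=> si; have B_gt0 := b_gt0 hb; have [j [k d]] := ex_distinct3 i.
have [ij ik jk] := and3P d; rewrite (cntS _ _ d).
have sl l := allsees_block l si.
have pij := pair_F ij ij (sl i) (sl j).
have pik := pair_F ik ik (sl i) (sl k).
have pjk := pair_F jk ik (sl j) (sl k).
have [ci|ci] := posnP (c i); first by lia.
have [cj|cj] := posnP (c j); first by lia.
have [ck|ck] := posnP (c k); first by lia.
have fj : sidefree n (slice X i) i j.
  by rewrite sidefreeC; apply: (allsees_side si); rewrite // eq_sym.
have fk : sidefree n (slice X i) i k.
  by rewrite sidefreeC; apply: (allsees_side si); rewrite // eq_sym.
have := block_bound_free hb mX d cj ck (sl i) fj fk.
have := block_bound hb mX (distinct3CA d) cj ci ck.
have := block_bound hb mX (distinct3CA (distinct3AC d)) ck ci cj.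
by rewrite !(strong0 (sl _)); clear; lia.
Qed.

Lemma step_G i j : i != j -> allsees n.+1 X i -> allsees n.+1 X j ->
  cnt n.+1 X <= 3 * B + 1.
Proof.
move=> ij si sj; have B_gt0 := b_gt0 hb; have d := thirdP ij.
set k := third i j in d *; have [_ ik jk] := and3P d; rewrite (cntS _ _ d).
have si' l := allsees_block l si; have sj' l := allsees_block l sj.
have g l : c l <= B + 1 by apply: (bG hb ij (mutvis_slice l mX)).
have := g i; have := g j; have := g k => gk gj gi.
have [ci|ci] := posnP (c i); first by lia.
have [cj|cj] := posnP (c j); first by lia.
have [ck|ck] := posnP (c k); first by lia.
have side a b : allsees n.+1 X a -> 0 < c b -> a != b -> sidefree n (slice X a) a b.
  by move=> sa cb ab; rewrite sidefreeC; apply: (allsees_side sa); rewrite // eq_sym.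
have ji : j != i by rewrite eq_sym.
have := block_bound_free hb mX d cj ck (si' i) (side _ _ si cj ij) (side _ _ si ck ik).
have := block_bound_free hb mX (distinct3CA d) ci ck (sj' j) (side _ _ sj ci ji) (side _ _ sj ck jk).
have := block_bound hb mX (distinct3CA (distinct3AC d)) ck ci cj.
by rewrite !(strong0 (si' _)) !(strong0 (sj' _)); clear; lia.
Qed.

Lemma step_H i j k : distinct3 i j k ->
  allsees n.+1 X i -> allsees n.+1 X j -> allsees n.+1 X k ->
  sidefree n.+1 X i j -> sidefree n.+1 X i k -> cnt n.+1 X <= 3 * B.
Proof.
move=> d si sj sk /andP[fij fji] /andP[fik fki]; have B_gt0 := b_gt0 hb.
have [ij ik jk] := and3P d; rewrite (cntS _ _ d).
have si' l := allsees_block l si; have sj' l := allsees_block l sj.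
have sk' l := allsees_block l sk; have mXl l := mutvis_slice l mX.
have gi : c i <= B by apply: (bH hb d).
have g l : c l <= B + 1 by apply: (bG hb ij).
have gj : 0 < c k -> c j <= B.
  move=> ck; apply: (bH hb (distinct3CA d)) => //; rewrite sidefreeC //.
  by apply: (allsees_side sj); rewrite // eq_sym.
have gk : 0 < c j -> c k <= B.
  move=> cj; apply: (bH hb (distinct3CA (distinct3AC d))) => //; rewrite sidefreeC //.
  exact: (allsees_side sk).
(* If block [j] or [k] is empty, the other has at most [B + 1] elements, and
   [2 * B + 1 <= 3 * B]. *)
have := g j; have := g k; have [cj0|/gk] := posnP (c j); have [ck0|/gj] := posnP (c k);
  move: gi B_gt0; rewrite ?cj0 ?ck0; clear; lia.
Qed.

(** Vertices of block [i] are nearer to corner [i], so that block is empty. If block [j] is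
    occupied, block [k] also sees corner [j]: a failure would reverse the inequality in block
    [j]. *)
Lemma E_split i k : i != k -> allsees n.+1 X k ->
  all_in n.+1 X (fun v => dc v k < dc v i) ->
  let j := third i k in
  [/\ cnt n.+1 X = c j + c k, all_in n (slice X j) (fun v => dc v k < dc v i),
      c k <= B + 2 & 0 < c j -> c k <= B + 1].
Proof.
move=> ik sk lt j; have d : distinct3 i j k := distinct3_third ik.
have [ij _ jk] := and3P d; have mXl l := mutvis_slice l mX.
have sk' l := allsees_block l sk.
have ltj : all_in n (slice X j) (fun v => dc v k < dc v i).
  apply/all_inP=> v sv Xv; have := all_inP _ _ _ lt (j :: v); rewrite /= sv => /(_ erefl Xv).
  by rewrite jk eq_sym ij; lia.
split=> //; last 1 first.
- move=> /cnt_exists[v [sv Xv]]; have kj : k != j by rewrite eq_sym.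
  apply: (bG hb kj (mXl k)) => //; apply/negPn/negP => f.
  have dk : distinct3 k j i by apply/distinct3CA/distinct3AC/distinct3CA.
  have [_ /all_inP/(_ v sv Xv)] := fails_E1 mX dk f.
  by rewrite ltnNge ltnW // (all_inP _ _ _ ltj).
- rewrite (cntS _ _ d); suff -> : c i = 0 by [].
  apply/eqP; rewrite -leqn0 leqNgt; apply/negP=> /cnt_exists[v [sv Xv]].
  have := all_inP _ _ _ lt (i :: v); rewrite /= sv eqxx (negbTE ik) => /(_ erefl Xv).
  by have := dc_lt v i; rewrite sv; clear; lia.
- exact: (bF hb (mXl k)).
Qed.

(** The induction only asks for [3 * B + 1]; the sharper bound is what excludes strong failures in
    [no_strong_large]. *)
Lemma step_E1 i k : i != k -> allsees n.+1 X k ->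
  all_in n.+1 X (fun v => dc v k < dc v i) -> cnt n.+1 X <= 2 * B + 2.
Proof.
move=> ik sk lt; have [-> ltj gk gk'] := E_split ik sk lt; have B_gt0 := b_gt0 hb.
by have := bE1 hb ik (mutvis_slice _ mX) (allsees_block _ sk) ltj; lia.
Qed.

Lemma step_E2 i k : i != k -> allsees n.+1 X k ->
  all_in n.+1 X (fun v => dc v k + 2 <= dc v i) -> cnt n.+1 X <= 3 * B.
Proof.
move=> ik sk lt2; have B_gt0 := b_gt0 hb.
have lt : all_in n.+1 X (fun v => dc v k < dc v i).
  by apply/all_inP=> v sv Xv; have := all_inP _ _ _ lt2 v sv Xv; lia.
have [-> _ gk gk'] := E_split ik sk lt.
set j := third i k in gk' *; have [ij _ jk] := and3P (distinct3_third ik).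
suff : c j <= B by lia.
apply: (bE2 hb ik (mutvis_slice _ mX) (allsees_block _ sk)); apply/all_inP=> v sv Xv.
have := all_inP _ _ _ lt2 (j :: v); rewrite /= sv => /(_ erefl Xv).
by rewrite [j == k](negbTE jk) eq_sym [i == j](negbTE ij); lia.
Qed.

End Step.

Lemma bounds_step n B : bounds n B -> bounds n.+1 (3 * B).
Proof.
move=> hb; have B_gt0 := b_gt0 hb; split.
- by lia.
- by move=> X mX; apply: (step_MU hb mX).
- by move=> X i mX; apply: (step_F hb mX).
- by move=> X i j ij mX; apply: (step_G hb mX ij).
- by move=> X i j k d mX; apply: (step_H hb mX d).
- by move=> X i k ik mX sk lt; have := step_E1 hb mX ik sk lt; lia.
- by move=> X i k ik mX; apply: (step_E2 hb mX ik).
Qed.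

Lemma bounds_all n : bounds n.+2 (3 ^ n).
Proof.
by elim: n => [|n IH]; [exact: bounds2|rewrite expnS; apply: bounds_step].
Qed.

(** At the maximum all three instances of [block_bound] are tight, so without charges every block
    has [B + 1] elements. *)
Lemma equality_charge n B X i j k :
  bounds n B -> mutvis n.+1 X -> cnt n.+1 X = 3 * B + 3 ->
  distinct3 i j k -> 0 < cnt n (slice X i) -> 0 < cnt n (slice X j) -> 0 < cnt n (slice X k) ->
  cnt n (slice X i) = B + 1 \/ exists i' j' k', distinct3 i' j' k' /\ strong n X i' j'.
Proof.
move=> hb mX eqX d ci cj ck.
have b1 := block_bound hb mX d ci cj ck.
have b2 := block_bound hb mX (distinct3CA d) cj ci ck.
have b3 := block_bound hb mX (distinct3CA (distinct3AC d)) ck ci cj.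
rewrite (cntS _ _ d) in eqX.
have mk a b e : distinct3 a b e -> strong n X a b ->
    cnt n (slice X i) = B + 1 \/ exists i' j' k', distinct3 i' j' k' /\ strong n X i' j' by right; exists a, b, e.
have [s|/negbTE s0] := boolP (strong n X i j); first exact: (mk _ _ _ d s).
have [s|/negbTE s1] := boolP (strong n X i k); first exact: (mk _ _ _ (distinct3AC d) s).
have [s|/negbTE s2] := boolP (strong n X j i); first exact: (mk _ _ _ (distinct3CA d) s).
have [s|/negbTE s3] := boolP (strong n X j k); first exact: (mk _ _ _ (distinct3AC (distinct3CA d)) s).
have [s|/negbTE s4] := boolP (strong n X k i); first exact: (mk _ _ _ (distinct3CA (distinct3AC d)) s).
have [s|/negbTE s5] := boolP (strong n X k j); first exact: (mk _ _ _ (distinct3AC (distinct3CA (distinct3AC d))) s).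
by left; rewrite s0 s1 s2 s3 s4 s5 in b1 b2 b3; lia.
Qed.

(** * Extremal sets *)

(** A strong failure leaves block [j] at most [2 * B + 2] elements, and the other two blocks at most
    [6 * B + 3] together. The sum [8 * B + 5] falls short of [9 * B + 3] once [B] is at least 3. *)
Lemma no_strong_large n B X i j k : bounds n B -> 3 <= B -> mutvis n.+2 X ->
  cnt n.+2 X = 9 * B + 3 -> distinct3 i j k ->
  0 < cnt n.+1 (slice X i) -> 0 < cnt n.+1 (slice X j) -> 0 < cnt n.+1 (slice X k) ->
  ~~ strong n.+1 X i j.
Proof.
move=> hb B3 mX eqX d ci cj ck; apply/negP => s.
have hb' := bounds_step hb; have f : fails n.+1 X i j by case/andP: s.
have b1 := block_bound hb' mX d ci cj ck.
have b3 := block_bound hb' mX (distinct3CA (distinct3AC d)) ck ci cj.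
have skj : strong n.+1 X k j = false.
  by rewrite /strong (negbTE (fails_excl mX d cj f)).
have [_ ik _] := and3P d; have [sjk ltj] := fails_E1 mX d f.
have le_j := step_E1 hb (mutvis_slice j mX) ik sjk ltj.
rewrite (cntS _ _ d) in eqX; rewrite s skj in b1 b3.
by move: eqX b1 b3 le_j B3; clear; lia.
Qed.

Lemma far_bad X i j k u : mutvis 4 X -> distinct3 i j k -> 2 < cnt 3 (slice X j) ->
  size u = 3 -> slice X i u -> ~~ sees (slice X i) u j ->
  sees (slice X i) u k && (dc u k + 5 <= dc u j).
Proof.
move=> mX d cj su Xu nu.
have f : fails 3 X i j by apply/all_inPn; exists u.
have [sjk _] := fails_E1 mX d f; have [_ ik _] := and3P d.
(* More than two elements force some [v] of margin at most 3; the detour term [2 ^ 3] then leaves a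
   margin of 5 for [u]. *)
have [E|/all_inPn[v [sv Xv lv]]] := boolP (all_in 3 (slice X j) (fun v => dc v k + 4 <= dc v i)).
  suff : cnt 3 (slice X j) <= 2 by move: cj; clear; lia.
  apply: (cnt_search (all_distinctP search_E4 d) (mutvis_slice j mX) E) => Y w YX sw Xw.
  exact: sees_subpred YX (all_inP _ _ _ sjk w sw Xw).
have [-> _ _ _ le] := detour mX d su sv Xu Xv nu.
by rewrite /=; move: le lv; rewrite [2 ^ 3]/=; lia.
Qed.

(** The count of [no_strong_large] does not suffice at [B = 1]. Here equality requires at least 5
    elements in block [i], while [search_far] allows 4. *)
Lemma no_strong_four X i j k : mutvis 4 X -> cnt 4 X = 12 -> distinct3 i j k ->
  0 < cnt 3 (slice X i) -> 0 < cnt 3 (slice X j) -> 0 < cnt 3 (slice X k) ->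
  ~~ strong 3 X i j.
Proof.
move=> mX eqX d ci cj ck; apply/negP => s; have hb := bounds_all 1.
have f : fails 3 X i j by case/andP: s.
have b1 := block_bound hb mX d ci cj ck.
have b2 := block_bound hb mX (distinct3CA d) cj ci ck.
have b3 := block_bound hb mX (distinct3CA (distinct3AC d)) ck ci cj.
have cj3 := strong_cnt hb mX d s.
have skj : strong 3 X k j = false.
  by rewrite /strong (negbTE (fails_excl mX d cj f)).
rewrite (cntS _ _ d) in eqX; rewrite s skj expn1 in b1 b2 b3 cj3.
have ski : strong 3 X k i = false.
  by apply/negP=> s'; have := strong_cnt hb mX (distinct3CA (distinct3AC d)) s'; rewrite s' expn1 in b1 b3 *; move: eqX b1 b2 b3 cj3; clear; lia.
rewrite ski in b1 b3.
suff : cnt 3 (slice X i) <= 4 by move: eqX b1 b2 b3 cj3; clear; lia.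
apply: (cnt_search (all_distinctP search_far d) (mutvis_slice i mX) (all_in_true _ _)) => Y u YX su Xu.
have seeY e : sees (slice X i) u e -> sees Y u e by apply: sees_subpred.
apply/andP; split; apply/orP.
  have [/seeY ->|nu] := boolP (sees (slice X i) u j); [by left|right].
  have cj2 : 2 < cnt 3 (slice X j) by move: eqX b1 b2 b3; clear; lia.
  by have /andP[/seeY -> ->] := far_bad mX d cj2 su Xu nu.
have [/seeY ->|nu] := boolP (sees (slice X i) u k); [by left|right].
have d' := distinct3AC d; have f' : fails 3 X i k by apply/all_inPn; exists u.
have [s'|ns'] := boolP (strong 3 X i k).
  have ck2 : 2 < cnt 3 (slice X k) by rewrite s' in b1 b2 b3; move: eqX b1 b2 b3 cj3; clear; lia.
  by have /andP[/seeY -> ->] := far_bad mX d' ck2 su Xu nu.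
have [v [sv Xv]] := cnt_exists ck.
have [/seeY -> _ _ _ _] := detour mX d' su sv Xu Xv nu.
(* A weak failure occurs only at corner [j...j], at distance 0 from itself and 7 from corner [k]. *)
have [_ /(_ u su Xu nu) ->] := weak_fail mX d' f' ns'; have [_ _ jk] := and3P d.
by rewrite /= eqxx jk.
Qed.

Lemma pairs_bound n X i j : mutvis n.+3 X -> i != j ->
  cnt n.+2 (slice X i) + cnt n.+2 (slice X j) <= 2 * 3 ^ n + 4.
Proof. by move=> mX ij; apply: (pair_bound (bounds_all n) mX ij). Qed.

Lemma equality_blocks n X : mutvis n.+4 X -> cnt n.+4 X = 3 ^ n.+2 + 3 ->
  forall i, cnt n.+3 (slice X i) = 3 ^ n.+1 + 1.
Proof.
move=> mX eqX i; have [j [k d]] := ex_distinct3 i; have [ij ik jk] := and3P d.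
have pij := pairs_bound mX ij; have pik := pairs_bound mX ik.
have pjk := pairs_bound mX jk; have n3 : 0 < 3 ^ n by rewrite expn_gt0.
have eqX' := eqX; rewrite (cntS _ _ d) !expnS in eqX' pij pik pjk *.
(* By the pair bounds two blocks alone cannot reach the total. *)
have ci : 0 < cnt n.+3 (slice X i) by lia.
have cj : 0 < cnt n.+3 (slice X j) by lia.
have ck : 0 < cnt n.+3 (slice X k) by lia.
have pos l : 0 < cnt n.+3 (slice X l) by have /or3P[] := distinct3_cover l d => /eqP->.
have hb := bounds_all n.+1; rewrite expnS in hb.
have eqX2 : cnt n.+4 X = 3 * (3 * 3 ^ n) + 3 by rewrite eqX !expnS.
have [//|[i' [j' [k' [d']]]]] := equality_charge hb mX eqX2 d ci cj ck.
case: n mX eqX n3 {pij pik pjk eqX' ci cj ck} pos hb eqX2 => [|n] mX eqX n3 pos hb eqX2.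
  by rewrite (negbTE (no_strong_four mX eqX d' (pos _) (pos _) (pos _))).
have eqX3 : cnt n.+4.+1 X = 9 * 3 ^ n.+1 + 3 by rewrite eqX2; lia.
rewrite (negbTE (no_strong_large (bounds_all n.+1) _ mX eqX3 d' (pos _) (pos _) (pos _))) //.
have : 0 < 3 ^ n by rewrite expn_gt0.
by rewrite expnS; lia.
Qed.

(* Words of length n+2; for n > 0 no side of S_3^(n+2) meets [Hset n i] and all its
   elements see all corners. For [Gset n c] this holds for the corners other than
   [c] and the side between them. *)
Fixpoint Hset n (i : 'I_3) : pred word :=
  if n is m.+1 then fun w => if w is l :: w' then Hset m l w' else false
  else fun w => w == [:: ordS i; ordS (ordS i)].

Fixpoint Gset n (c : 'I_3) : pred word :=
  if n is m.+1 then
    fun w => if w is l :: w' then (if l == c then Gset m c else Hset m l) w' else false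
  else fun w => w \in [:: [:: ordS c; c]; [:: ordS (ordS c); c]].

(** Corner [i...i] of block [i] leads to no other block, so it is the one exempted in [Gset n i]. *)
Definition Xset n : pred word := fun w => if w is i :: w' then Gset n i w' else false.

Definition Xset2 : pred word :=
  fun w => w \in [:: [:: o0; o0]; [:: o0; o1]; [:: o2; o1]; [:: o2; o2]].

(** * Gluing blocks and the size of the examples *)

Lemma vis_same X i u v : vis X (i :: u) (i :: v) = vis (slice X i) u v.
Proof. by rewrite /= eqxx. Qed.

(** Both the direct route and the detour are free, so whichever is shorter serves. *)
Lemma vis_glue n X i j k u v : distinct3 i j k -> size u = n -> size v = n ->
  sees (slice X i) u j -> sees (slice X i) u k -> sees (slice X j) v i -> sees (slice X j) v k ->
  sidefree n (slice X k) i j -> vis X (i :: u) (j :: v).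
Proof.
by move=> d su sv h1 h2 h3 h4 h5; rewrite (visE _ _ _ d) su h1 h2 h3 h4 h5 !andbT leq_total.
Qed.

Lemma mutvis_glue n X : (forall i, mutvis n (slice X i)) ->
  (forall i j, i != j -> allsees n (slice X i) j) ->
  (forall i j k, distinct3 i j k -> sidefree n (slice X k) i j) -> mutvis n.+1 X.
Proof.
move=> mX sX fX; apply/all_inP=> -[|i u] // [su] Xu; apply/all_inP=> -[|j v] // [sv] Xv.
have [E|ij] := eqVneq i j.
  move: Xv; rewrite -E vis_same => Xv.
  by apply: (all_inP _ _ _ (all_inP _ _ _ (mX i) u su Xu)).
have d := thirdP ij; have [_ ik jk] := and3P d; have ji : j != i by rewrite eq_sym.
apply: (vis_glue d su sv); try exact: fX.
- exact: (all_inP _ _ _ (sX i j ij)).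
- exact: (all_inP _ _ _ (sX i _ ik)).
- exact: (all_inP _ _ _ (sX j i ji)).
- exact: (all_inP _ _ _ (sX j _ jk)).
Qed.

Lemma allsees_glue n X c : (forall i, allsees n (slice X i) c) ->
  (forall i, i != c -> sidefree n (slice X c) i c) -> allsees n.+1 X c.
Proof.
move=> sX fX; apply/all_inP=> -[|i u] //= [su] Xu.
rewrite (all_inP _ _ _ (sX i) u su Xu) su /=.
by have [//|ic] := eqVneq i c; apply: fX.
Qed.

Lemma HsetS n i l : slice (Hset n.+1 i) l = Hset n l.
Proof. by []. Qed.

Lemma GsetS n c l : slice (Gset n.+1 c) l = if l == c then Gset n c else Hset n l.
Proof. by []. Qed.

(** The induction starts at length 3: the one vertex of [Hset 0 i] lies on the side between corners
    [ordS i] and [ordS (ordS i)]. *)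
Lemma Hset_ok n i : [/\ mutvis n.+3 (Hset n.+1 i), forall c, allsees n.+3 (Hset n.+1 i) c &
  forall a b, a != b -> sidefree n.+3 (Hset n.+1 i) a b].
Proof.
elim: n i => [|n IH] i.
  split; first by elim/I3_ind: i; vm_compute.
    by move=> c; elim/I3_ind: i; elim/I3_ind: c; vm_compute.
  by move=> a b; elim/I3_ind: i; elim/I3_ind: a; elim/I3_ind: b => ab; vm_compute.
have mH l : mutvis n.+3 (Hset n.+1 l) by have [] := IH l.
have sH l c : allsees n.+3 (Hset n.+1 l) c by have [_ + _] := IH l; apply.
have fH l a b : a != b -> sidefree n.+3 (Hset n.+1 l) a b.
  by have [_ _] := IH l; apply.
split.
- apply: mutvis_glue => [l|l c _|a b k d]; rewrite HsetS //.
  by apply: fH; case/and3P: d.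
- by move=> c; apply: allsees_glue => [l|l lc]; rewrite HsetS //; apply: fH.
- move=> a b ab; apply/andP; split; exact: fH.
Qed.

Lemma Gset_ok n c : [/\ mutvis n.+2 (Gset n c),
  forall a, a != c -> allsees n.+2 (Gset n c) a &
  forall a b, distinct3 a b c -> sidefree n.+2 (Gset n c) a b].
Proof.
elim: n => [|[|n] IH].
- split; first by elim/I3_ind: c; vm_compute.
    by move=> a; elim/I3_ind: c; elim/I3_ind: a => ac; vm_compute.
  by move=> a b; elim/I3_ind: c; elim/I3_ind: a; elim/I3_ind: b => ab; vm_compute.
(* Second base case: [Gset 1 c] contains blocks [Hset 0 l], to which [Hset_ok] does not apply. *)
- split; first by elim/I3_ind: c {IH}; vm_compute.
    by move=> a; elim/I3_ind: c {IH}; elim/I3_ind: a => ac; vm_compute.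
  by move=> a b; elim/I3_ind: c {IH}; elim/I3_ind: a; elim/I3_ind: b => ab; vm_compute.
case: IH => mG sG fG.
have mH l : mutvis n.+3 (Hset n.+1 l) by have [] := Hset_ok n l.
have sH l a : allsees n.+3 (Hset n.+1 l) a by have [_ + _] := Hset_ok n l; apply.
have fH l a b : a != b -> sidefree n.+3 (Hset n.+1 l) a b.
  by have [_ _] := Hset_ok n l; apply.
split.
- apply: mutvis_glue => [l|l a la|a b k d]; rewrite GsetS.
  + by case: eqP.
  + by have [E|//] := eqVneq l c; apply: sG; rewrite -E eq_sym.
  + have [E|_] := eqVneq k c; first by apply: fG; rewrite -E.
    by apply: fH; case/and3P: d.
- move=> a ac; apply: allsees_glue => [l|l la]; rewrite GsetS.
  + by case: eqP => // _; apply: sG.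
  + by rewrite (negbTE ac); apply: fH.
- move=> a b /and3P[ab ac bc]; apply/andP; split; rewrite GsetS.
  + by rewrite (negbTE ac); apply: fH.
  + by rewrite (negbTE bc); apply: fH.
Qed.

Lemma Xset_mutvis n : mutvis n.+3 (Xset n).
Proof.
apply: mutvis_glue => [i|i j ij|i j k d]; have [mG sG fG] := Gset_ok n i => //.
  by apply: sG; rewrite eq_sym.
by have [_ _ +] := Gset_ok n k; apply.
Qed.

Lemma Xset2_mutvis : mutvis 2 Xset2.
Proof. by vm_compute. Qed.

Lemma Xset2_cnt : cnt 2 Xset2 = 4.
Proof. by vm_compute. Qed.

Lemma Hset_cnt n i : cnt n.+2 (Hset n i) = 3 ^ n.
Proof.
elim: n i => [|n IH] i; first by elim/I3_ind: i; vm_compute.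
by rewrite (cntS _ _ (isT : distinct3 o0 o1 o2)) !HsetS !IH expnS; lia.
Qed.

Lemma Gset_cnt n c : cnt n.+2 (Gset n c) = 3 ^ n + 1.
Proof.
elim: n => [|n IH]; first by elim/I3_ind: c; vm_compute.
have [a [b d]] := ex_distinct3 c; have [ca cb _] := and3P d.
rewrite (cntS _ _ d) !GsetS eqxx ![_ == c]eq_sym (negbTE ca) (negbTE cb).
by rewrite IH !Hset_cnt expnS; lia.
Qed.

Lemma Xset_cnt n : cnt n.+3 (Xset n) = 3 ^ n.+1 + 3.
Proof.
rewrite (cntS _ _ (isT : distinct3 o0 o1 o2)).
have E i : slice (Xset n) i = Gset n i by [].
by rewrite !E !Gset_cnt expnS; lia.
Qed.

(** * Geodesics of S_3^n *)

Fixpoint adj (u v : word) : bool :=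
  match u, v with
  | i :: u', j :: v' =>
    if i == j then adj u' v'
    else (u' == nseq (size v') j) && (v' == nseq (size u') i)
  | _, _ => false
  end.

(** The final successor counts one bridge between blocks. The detour has a second bridge and a side
    of [2 ^ size u' - 1] edges, hence its middle term. *)
Fixpoint dist (u v : word) : nat :=
  match u, v with
  | i :: u', j :: v' =>
    if i == j then dist u' v' else
    (minn (dc u' j + dc v' i) (dc u' (third i j) + 2 ^ size u' + dc v' (third i j))).+1
  | _, _ => 0
  end.

Lemma adj_size u v : adj u v -> size u = size v.
Proof.
elim: u v => [|i u IH] [|j v] //=; case: eqP => _; first by move/IH->.
by case/andP=> /eqP E _; rewrite E size_nseq.
Qed.

Lemma adjC u v : adj u v = adj v u.
Proof.
elim: u v => [|i u IH] [|j v] //=; rewrite (eq_sym j i); case: eqP => _; first exact: IH.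
by rewrite andbC.
Qed.

Lemma adjP (x y : word) : size x = size y -> reflect
  (exists2 h, h < size x & nth o0 x h != nth o0 y h /\ forall t, t < size x ->
    (t < h -> nth o0 x t = nth o0 y t) /\
    (h < t -> nth o0 x t = nth o0 y h /\ nth o0 y t = nth o0 x h)) (adj x y).
Proof.
elim: x y => [|i x IH] [|j y] //=; first by move=> _; apply: ReflectF => -[].
case=> sxy; have [<-|ij] := eqVneq i j.
  apply: (iffP (IH y sxy)) => [[h hx [ne nb]]|[[|h] hx [ne nb]]].
  - exists h.+1 => //; split=> // -[|t] tx; first by split.
    by have [h1 h2] := nb t tx.
  - by rewrite /= eqxx in ne.
  - by exists h => //; split=> // t tx; have [] := nb t.+1 tx.
apply: (iffP andP) => [[/eqP Ex /eqP Ey]|[[|h] hx [ne nb]]].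
- exists 0 => //; split=> // -[|t] //= tx; split=> // _.
  rewrite ltnS in tx.
  by split; [rewrite Ex nth_nseq -sxy tx|rewrite Ey nth_nseq tx].
- split; apply/eqP; apply: (@eq_from_nth _ o0); rewrite ?size_nseq // => t tx.
    by have [_ /(_ isT)[]] := nb t.+1 tx; rewrite nth_nseq -sxy tx.
  by rewrite -sxy in tx; have [_ /(_ isT)[]] := nb t.+1 tx; rewrite nth_nseq tx.
- by have [/(_ isT)] := nb 0 isT; move/eqP; rewrite (negbTE ij).
Qed.

Lemma distE i j k u v : distinct3 i j k ->
  dist (i :: u) (j :: v) =
    (minn (dc u j + dc v i) (dc u k + 2 ^ size u + dc v k)).+1.
Proof. by move=> d /=; rewrite (thirdE d); case/and3P: d => /negbTE->. Qed.

Lemma distC u v : size u = size v -> dist u v = dist v u.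
Proof.
elim: u v => [|i u IH] [|j v] //= [E]; rewrite (eq_sym j i); case: eqP => _; first exact: IH.
by rewrite thirdC E; congr (minn _ _).+1; lia.
Qed.

Lemma distuu u : dist u u = 0.
Proof. by elim: u => //= i u; rewrite eqxx. Qed.

Lemma dc_nseq n c : dc (nseq n c) c = 0.
Proof. by elim: n => //= n ->; rewrite eqxx. Qed.

Lemma dc_nseq_neq n (i c : 'I_3) : i != c -> (dc (nseq n i) c).+1 = 2 ^ n.
Proof. by move=> ic; elim: n => //= n IH; rewrite ic size_nseq expnS; lia. Qed.

Lemma dist_corner u c : dist u (nseq (size u) c) = dc u c.
Proof.
elim: u => //= i u IH; have [_|ic] := eqVneq i c; first by rewrite IH.
have ci : c != i by rewrite eq_sym.
have /and3P[_ _ ck] := thirdP ic.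
have := dc_nseq_neq (size u) ci; have := dc_nseq_neq (size u) ck.
by have := dc_lt u c; rewrite /= mul1n; lia.
Qed.

Lemma dc_adj u v c : adj u v -> dc u c <= (dc v c).+1.
Proof.
elim: u v => [|i u IH] [|j v] //=; have [->|ij] := eqVneq i j.
  by move=> uv; rewrite (adj_size uv) -addnS leq_add2l; exact: IH.
case/andP=> /eqP Eu /eqP Ev.
have sz : size u = size v by rewrite Eu size_nseq.
rewrite Eu Ev !size_nseq.
have [E|ic] := eqVneq i c; have [E'|jc] := eqVneq j c; rewrite /= ?mul1n ?mul0n.
- by rewrite E E' eqxx in ij.
- by have := dc_nseq_neq (size u) jc; lia.
- by have := dc_nseq_neq (size u) ic; rewrite E' dc_nseq; lia.
- by have := dc_nseq_neq (size u) ic; have := dc_nseq_neq (size u) jc; lia.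
Qed.

Lemma dist_corner_l w c : dist (nseq (size w) c) w = dc w c.
Proof. by rewrite distC ?size_nseq ?dist_corner. Qed.

(** An edge changes [dist] by at most one, which makes [dist] a lower bound for path lengths. *)
Lemma dist_adj u v w : adj u v -> size w = size u -> dist u w <= (dist v w).+1.
Proof.
elim: u v w => [|i u IH] [|l v] // [|j w] // uv [sw].
have sz : size u = size v by have [] := adj_size uv.
move: uv => /=; have [<-|il] := eqVneq i l => uv.
  have [_|ij] := eqVneq i j; first exact: IH.
  have := dc_adj j uv; have := dc_adj (third i j) uv; rewrite sz; lia.
change (dist (i :: u) (j :: w) <= (dist (l :: v) (j :: w)).+1).
(* The edge is the bridge between blocks [i] and [l]; what remains is a case split on the block of
   [w]. *)
have [-> ->] : u = nseq (size w) l /\ v = nseq (size w) i.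
  by case/andP: uv => /eqP Eu /eqP Ev; split; [rewrite sw sz; exact: Eu|rewrite sw; exact: Ev].
have Nn (e e' : 'I_3) : e != e' -> (dc (nseq (size w) e) e').+1 = 2 ^ size w := @dc_nseq_neq _ e e'.
have N0 e : dc (nseq (size w) e) e = 0 by apply: dc_nseq.
have lw e : dc w e < 2 ^ size w by apply: dc_lt.
have li : l != i by rewrite eq_sym.
have [E|ij] := eqVneq i j.
  rewrite -E; have d := thirdP li; have [_ lk ik] := and3P d.
  rewrite (distE _ _ d) /= eqxx dist_corner_l N0 size_nseq.
  by have := Nn i _ ik; have := lw l; clear; lia.
have [E|lj] := eqVneq l j.
  rewrite -E; have d := thirdP il; have [_ ik lk] := and3P d.
  rewrite (distE _ _ d) /= eqxx dist_corner_l N0 size_nseq.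
  by have := Nn l _ lk; have := lw i; clear; lia.
have ji : j != i by rewrite eq_sym.
have jl : j != l by rewrite eq_sym.
have d : distinct3 i j l by rewrite /distinct3 ij il jl.
have d' : distinct3 l j i by rewrite /distinct3 lj li ji.
rewrite (distE _ _ d) (distE _ _ d') !size_nseq !N0.
by have := Nn l j lj; have := Nn i j ij; have := lw i; have := lw l; clear; lia.
Qed.

Lemma path_size u p v : path adj u p -> v \in p -> size v = size u.
Proof.
elim: p u => //= w p IH u /andP[uw wp]; rewrite inE => /orP[/eqP->|vp].
  by rewrite (adj_size uw).
by rewrite (IH w) ?(adj_size uw).
Qed.

Lemma path_last_size u p : path adj u p -> size (last u p) = size u.
Proof. by case: p => // w p up; apply: (path_size up); rewrite /= mem_last. Qed.

Lemma dist_le_path u p v : path adj u p -> last u p = v -> dist u v <= size p.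
Proof.
elim: p u => [|w p IH] u /= => [_ <-|/andP[uw wp] E]; first by rewrite distuu.
apply: leq_trans (dist_adj uw _) _; last by rewrite ltnS IH.
by rewrite -E (path_last_size wp) (adj_size uw).
Qed.

(** A path of length [dist] is shortest by [dist_le_path]; this form is decidable and passes to
    tails. *)
Definition geo u p v := [&& path adj u p, last u p == v & size p == dist u v].

Lemma geo_cons u w p v : geo u (w :: p) v ->
  [/\ adj u w, geo w p v & dist u v = (dist w v).+1].
Proof.
case/and3P=> /= /andP[uw wp] /eqP E /eqP s.
have sv : size v = size u by rewrite -E (path_last_size wp) (adj_size uw).
have := dist_le_path wp E; have := dist_adj uw sv => h1 h2.
by split; [|apply/and3P; split; try exact/eqP|]; rewrite //; try apply/eqP; lia.
Qed.

Lemma geo_size u p v : geo u p v -> size v = size u.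
Proof. by case/and3P=> up /eqP <- _; apply: path_last_size. Qed.

Lemma geo_path u p v : geo u p v -> path adj u p /\ last u p = v.
Proof. by case/and3P=> ? /eqP. Qed.

Lemma geo_notin u p v : geo u p v -> u \notin p.
Proof.
move=> g; suff lt w : w \in p -> dist w v < dist u v by apply/negP=> /lt; rewrite ltnn.
elim: p u g => //= x p IH u /geo_cons[_ g E]; rewrite inE => /orP[/eqP->|wp].
  by rewrite E.
by have := IH _ g wp; lia.
Qed.

Lemma geo_rev u p v : geo u p v -> geo v (rev (belast u p)) u.
Proof.
move=> g; have sz := geo_size g; case/and3P: g => up /eqP E /eqP s.
apply/and3P; split.
- by rewrite -{1}E rev_path (eq_path (e' := adj)) // => x y; rewrite adjC.
- case: p {up s} E => [|w p] /= E; first by rewrite E.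
  by rewrite rev_cons last_rcons.
- by rewrite size_rev size_belast s distC.
Qed.

Lemma geo_nil u : geo u [::] u.
Proof. by rewrite /geo /= eqxx distuu. Qed.

Lemma adj_cons i u v : adj (i :: u) (i :: v) = adj u v.
Proof. by rewrite /= eqxx. Qed.

Lemma path_lift i u p : path adj (i :: u) (map (cons i) p) = path adj u p.
Proof. by rewrite path_map; apply: eq_path => x y; rewrite /= eqxx. Qed.

Lemma adj_bridge n (i j : 'I_3) : i != j -> adj (i :: nseq n j) (j :: nseq n i).
Proof. by move=> /negbTE ij /=; rewrite ij !size_nseq !eqxx. Qed.

Lemma geo_lift i u p v : geo u p v -> geo (i :: u) (map (cons i) p) (i :: v).
Proof.
case/and3P=> up /eqP E s; apply/and3P; split; first by rewrite path_lift.
  by rewrite last_map E.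
by rewrite size_map /= eqxx.
Qed.

Lemma geo_step u x p v : adj u x -> geo x p v -> dist u v = (dist x v).+1 ->
  geo u (x :: p) v.
Proof.
move=> ux /and3P[xp /eqP E /eqP s] d; apply/and3P; split; rewrite /= ?ux ?E //.
by rewrite s d.
Qed.

Lemma bridgeP (i l : 'I_3) u x : i != l -> adj (i :: u) (l :: x) ->
  u = nseq (size u) l /\ x = nseq (size u) i.
Proof.
move=> /negbTE il ux; have /= [su] := adj_size ux; move: ux => /=.
by rewrite il => /andP[/eqP Eu /eqP Ex]; split; [rewrite su; exact: Eu|exact: Ex].
Qed.

(** A geodesic leaving block [i] would do so at a corner [l...l]; from across the bridge the
    shortest way to [v] leads straight back. *)
Lemma geo_same i u p v : geo (i :: u) p (i :: v) ->
  exists2 q, p = map (cons i) q & geo u q v.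
Proof.
elim: p u => [|[|l x] p IH] u g.
- by exists [::] => //; case/and3P: g => _ /= /eqP[->] _; apply: geo_nil.
- by have [] := geo_cons g.
have [ux gx E] := geo_cons g; have /= [svu] := geo_size g.
have [il|il] := eqVneq i l.
  move: ux gx E; rewrite -il adj_cons => ux /IH[q -> gq].
  rewrite /= eqxx => E; exists (x :: q) => //; exact: geo_step.
have [Eu Ex] := bridgeP il ux.
have li : l != i by rewrite eq_sym.
move: E; rewrite (distE _ _ (thirdP li)) {1}Eu Ex size_nseq dc_nseq -svu /= eqxx dist_corner_l.
by have := dc_lt v l; lia.
Qed.

(** Induction along the path, by the block entered in the first step. The pieces are the legs that
    [vis] tests through [sees] and [sidefree]. *)
Lemma geo_diff i j k u p v : distinct3 i j k -> geo (i :: u) p (j :: v) ->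
  let n := size u in
  (exists p1 p2,
    [/\ p = map (cons i) p1 ++ map (cons j) (nseq n i :: p2),
        geo u p1 (nseq n j), geo (nseq n i) p2 v &
        dc u j + dc v i <= dc u k + 2 ^ n + dc v k]) \/
  (exists p1 p2 p3,
    [/\ p = map (cons i) p1 ++ map (cons k) (nseq n i :: p2)
              ++ map (cons j) (nseq n k :: p3),
        geo u p1 (nseq n k), geo (nseq n i) p2 (nseq n j), geo (nseq n k) p3 v &
        dc u k + 2 ^ n + dc v k <= dc u j + dc v i]).
Proof.
elim: p i k u => [|[|l x] p IH] i k u d g n.
- by have /and3P[/eqP ij _ _] := d; case/and3P: g => _ /= /eqP[].
- by have [] := geo_cons g.
have [ij ik jk] := and3P d.
have [ux gx E] := geo_cons g; have /= [svu] := geo_size g.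
have le0 := @dc_lt v.
have /or3P[/eqP Ei|/eqP Ej|/eqP Ek] := distinct3_cover l d.
- move: ux gx E; rewrite Ei adj_cons => ux gx E.
  have sx := adj_size ux; have hj := dc_adj j ux; have hk := dc_adj k ux.
  have Dx c : dist x (nseq n c) = dc x c by rewrite /n sx dist_corner.
  have Du c : dist u (nseq n c) = dc u c by rewrite dist_corner.
  move: E; rewrite !(distE _ _ d) => E.
  have := IH i k x d gx; rewrite /= -sx -/n in E *.
  have ml := geq_minl (dc u j + dc v i) (dc u k + 2 ^ n + dc v k).
  have mr := geq_minr (dc u j + dc v i) (dc u k + 2 ^ n + dc v k).
  case=> [[p1 [p2 [-> g1 g2 le]]]|[p1 [p2 [p3 [-> g1 g2 g3 le]]]]]; [left|right].
    rewrite (minn_idPl le) in E; case: E ml mr => -> ml mr.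
    exists (x :: p1), p2; split=> //; last by move: hj mr; clear; lia.
    by apply: geo_step; rewrite // Dx Du; move: hj ml; clear; lia.
  rewrite (minn_idPr le) in E; case: E ml mr => -> ml mr.
  exists (x :: p1), p2, p3; split=> //; last by move: hk ml; clear; lia.
  by apply: geo_step; rewrite // Dx Du; move: hk mr; clear; lia.
- left; move: ux gx E; rewrite Ej => /(bridgeP ij) [Eu Ex] gx _.
  have [q -> gq] := geo_same gx; exists [::], q.
  split=> //; [by rewrite Ex|by rewrite {1}Eu; apply: geo_nil|by rewrite -/n -Ex|].
  by rewrite {1}Eu dc_nseq; have := le0 i; rewrite svu -/n; lia.
- right; move: ux gx E; rewrite Ek => /(bridgeP ik) [Eu Ex] gx E; rewrite -/n in Eu Ex.
  have dk : distinct3 k j i by apply/distinct3CA/distinct3AC/distinct3CA.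
  have sx : size x = n by rewrite Ex size_nseq.
  move: E; rewrite (distE _ _ d) (distE _ _ dk) sx Eu Ex size_nseq !dc_nseq => E.
  have kj : k != j by rewrite eq_sym.
  have := dc_nseq_neq n kj; have := dc_nseq_neq n ij; have := le0 i; have := le0 k.
  rewrite svu -/n => b1 b2 b3 b4.
  have := IH k i x dk gx; rewrite /= sx.
  (* After the crossing into block [k], a return through block [i] is impossible: the direct route
     from [u] would be shorter. *)
  case=> [[p1 [p2 [-> g1 g2 le]]]|[p1 [p2 [p3 [_ g1 g2 g3 le]]]]]; last first.
    move: le; rewrite Ex dc_nseq => le; rewrite (minn_idPr le) in E.
    have := geq_minl (dc (nseq n k) j + dc v i) (0 + 2 ^ n + dc v k).
    by case: E => ->; move: b4; clear; lia.
  exists [::], p1, p2; split=> //.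
  - exact: geo_nil.
  - by rewrite -Ex.
  - move: le; rewrite Ex dc_nseq => le; rewrite (minn_idPl le) in E.
    have := geq_minl (dc (nseq n k) j + dc v i) (0 + 2 ^ n + dc v k).
    by case: E => ->; rewrite add0n -b3 addSn.
Qed.

Local Arguments adj : simpl never.
Local Arguments dist : simpl never.

Lemma geo_direct i j k u v p1 p2 : distinct3 i j k ->
  geo u p1 (nseq (size u) j) -> geo (nseq (size u) i) p2 v ->
  dc u j + dc v i <= dc u k + 2 ^ size u + dc v k ->
  geo (i :: u) (map (cons i) p1 ++ map (cons j) (nseq (size u) i :: p2)) (j :: v).
Proof.
move=> d g1 g2 le; have [ij _ _] := and3P d.
have /= sv := geo_size g2; rewrite size_nseq in sv.
case/and3P: g1 => up1 /eqP e1; rewrite dist_corner => /eqP s1.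
case/and3P: g2 => up2 /eqP e2; rewrite -{1}sv dist_corner_l => /eqP s2.
apply/and3P; split.
- by rewrite cat_path path_lift up1 last_map e1 /= path_lift up2 (adj_bridge _ ij).
- by rewrite last_cat /= last_map e2.
- by rewrite size_cat /= !size_map s1 s2 (distE _ _ d) (minn_idPl le) addnS.
Qed.

Lemma geo_detour i j k u v p1 p2 p3 : distinct3 i j k ->
  geo u p1 (nseq (size u) k) -> geo (nseq (size u) i) p2 (nseq (size u) j) ->
  geo (nseq (size u) k) p3 v ->
  dc u k + 2 ^ size u + dc v k <= dc u j + dc v i ->
  geo (i :: u) (map (cons i) p1 ++ map (cons k) (nseq (size u) i :: p2)
    ++ map (cons j) (nseq (size u) k :: p3)) (j :: v).
Proof.
move=> d g1 g2 g3 le; have [ij ik jk] := and3P d.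
have /= sv := geo_size g3; rewrite size_nseq in sv.
case/and3P: g1 => up1 /eqP e1; rewrite dist_corner => /eqP s1.
case/and3P: g2 => up2 /eqP e2.
have := dist_corner (nseq (size u) i) j; rewrite size_nseq => -> /eqP s2.
case/and3P: g3 => up3 /eqP e3; rewrite -{1}sv dist_corner_l => /eqP s3.
have kj : k != j by rewrite eq_sym.
apply/and3P; split.
- rewrite cat_path path_lift up1 last_map e1 /= (adj_bridge _ ik) cat_path path_lift up2.
  by rewrite last_map e2 /= (adj_bridge _ kj) path_lift.
- by rewrite !last_cat /= last_cat /= last_map e3.
- rewrite !size_cat /= size_cat /= !size_map s1 s2 s3 (distE _ _ d).
  by rewrite (minn_idPr le); have := dc_nseq_neq (size u) ij => <-; apply/eqP; lia.
Qed.

Lemma sidefree_sees n X i c : i != c ->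
  sidefree n X i c = ~~ X (nseq n i) && sees X (nseq n i) c.
Proof.
move=> ic; elim: n X => [|n IH] X /=; first by rewrite andbT.
by rewrite IH (negbTE ic) size_nseq andbA.
Qed.

Lemma seesP X u c : sees X u c <->
  exists2 p, geo u p (nseq (size u) c) & forall x, x \in p -> ~~ X x.
Proof.
(* Induction on the length, since the hypothesis is needed at the tail of [u] and at the corner
   where the path enters block [c]. *)
move: {2}(size u) (erefl (size u)) => n; elim: n u X => [|n IH] [|i u] X //= => [_|[su]].
  by split=> // _; exists [::] => //; apply: geo_nil.
have [->|ic] := eqVneq i c; rewrite /= ?andbT.
  split=> [/(IH _ _ su)[p g fr]|[p /geo_same[q -> g] fr]].
    exists (map (cons c) p); first exact: geo_lift.
    by move=> x /mapP[y yp ->]; apply: fr.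
  by apply/(IH _ _ su); exists q => // x xq; apply: fr; apply: map_f.
rewrite sidefree_sees //.
have d := thirdP ic; have [_ ik ck] := and3P d.
have e1 := dc_nseq_neq (size u) (_ : c != i); rewrite eq_sym in e1; have {}e1 := e1 ic.
have e2 := dc_nseq_neq (size u) ck; have e3 := dc_lt u c.
have sn : size (nseq (size u) i) = n by rewrite size_nseq.
have IHn := IH (nseq (size u) i) (slice X c) sn; rewrite size_nseq in IHn.
split=> [/and3P[/(IH _ _ su)[p1 g1 fr1] ni /IHn[p2 g2 fr2]]|].
  exists (map (cons i) p1 ++ map (cons c) (nseq (size u) i :: p2)).
    apply: (geo_direct d) => //.
    by lia.
  move=> x; rewrite mem_cat => /orP[] /mapP[y yp ->]; first exact: fr1.
  by move: yp; rewrite inE => /orP[/eqP->|/fr2].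
case=> p /(geo_diff d) /= [[p1 [p2 [-> g1 g2 le]]] fr|[p1 [p2 [p3 [_ _ _ _ le]]]]]; last first.
  by move=> _; lia.
apply/and3P; split.
- by apply/(IH _ _ su); exists p1 => // x xp; apply: fr; rewrite mem_cat map_f.
- by apply: fr; rewrite mem_cat inE eqxx orbT.
- by apply/IHn; exists p2 => // x xp; apply: fr; rewrite mem_cat inE map_f ?orbT.
Qed.

Lemma rev_belast (T : Type) (a : T) s : belast (last a s) (rev (belast a s)) = rev s.
Proof.
have E : last a s :: rev (belast a s) = rcons (rev s) a.
  by rewrite -rev_cons [in RHS]lastI rev_rcons.
by have := lastI (last a s) (rev (belast a s)); rewrite E => /rcons_inj[->].
Qed.

(** The last leg of a path runs from a corner to its end; [belast] keeps the corner and drops that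
    end. *)
Lemma seesP_rev X u c : sees X u c <->
  exists2 p, geo (nseq (size u) c) p u
           & forall x, x \in belast (nseq (size u) c) p -> ~~ X x.
Proof.
split=> [/seesP[p g fr]|[p g fr]].
  exists (rev (belast u p)); first exact: geo_rev.
  have [_ <-] := geo_path g.
  by move=> x; rewrite rev_belast mem_rev; apply: fr.
apply/seesP; exists (rev (belast (nseq (size u) c) p)); first exact: geo_rev.
by move=> x; rewrite mem_rev; apply: fr.
Qed.

(** [geo_diff] cuts a geodesic into legs and [geo_direct] and [geo_detour] reassemble them, so the
    recursive test is exact. *)
Lemma visP X u v : size u = size v -> vis X u v <->
  exists2 p, geo u p v & forall x, x \in u :: p -> X x -> (x == u) || (x == v).
Proof.
elim: u v X => [|i u IH] [|j v] X //= => [_|[suv]].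
  split=> // _; exists [::]; first exact: geo_nil.
  by move=> x; rewrite inE => ->.
have [<-|ij] := eqVneq i j.
  split=> [/(IH _ _ suv)[p g fr]|[p /geo_same[q -> g] fr]].
    exists (map (cons i) p); first exact: geo_lift.
    by move=> x; rewrite -map_cons => /mapP[y yp ->] /(fr y yp); rewrite !eqseq_cons eqxx.
  apply/(IH _ _ suv); exists q => // x xq Xx.
  have := fr (i :: x); rewrite -[(i :: u) :: _]/(map (cons i) (u :: q)) => /(_ _ Xx).
  by rewrite map_f // !eqseq_cons eqxx; apply.
have d := thirdP ij; set k := third i j in d *; have [_ ik jk] := and3P d.
split.
  case/orP.
    case/and3P=> le /seesP[p1 g1 fr1] /seesP_rev[p2]; rewrite -suv => g2 fr2.
    exists (map (cons i) p1 ++ map (cons j) (nseq (size u) i :: p2)); first exact: geo_direct d _ _ _.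
    move=> x; rewrite inE mem_cat => /or3P[-> //||] /mapP[y yp ->] Xy.
      by case/negP: (fr1 _ yp).
    move: yp; rewrite lastI mem_rcons inE => /orP[/eqP->|/fr2/negP[] //].
    by have [_ ->] := geo_path g2; rewrite eqxx orbT.
  case/and4P=> le /seesP[p1 g1 fr1] /seesP_rev[p3]; rewrite -suv => g3 fr3.
  rewrite sidefree_sees // => /andP[ni /seesP[p2]]; rewrite size_nseq => g2 fr2.
  exists (map (cons i) p1 ++ map (cons k) (nseq (size u) i :: p2)
    ++ map (cons j) (nseq (size u) k :: p3)); first exact: geo_detour d _ _ _ _.
  move=> x; rewrite inE !mem_cat => /or4P[-> //|||] /mapP[y yp ->] Xy.
  - by case/negP: (fr1 _ yp).
  - by move: yp; rewrite inE => /orP[/eqP E|/fr2/negP[] //]; case/negP: ni; rewrite -E.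
  - move: yp; rewrite lastI mem_rcons inE => /orP[/eqP->|/fr3/negP[] //].
    by have [_ ->] := geo_path g3; rewrite eqxx orbT.
case=> p /(geo_diff d); cbv zeta.
case=> [[p1 [p2 [-> g1 g2 le]]]|[p1 [p2 [p3 [-> g1 g2 g3 le]]]]] fr.
  apply/orP; left; rewrite le /=; apply/andP; split.
    apply/seesP; exists p1 => // x xp; apply/negP=> Xx.
    have := fr (i :: x); rewrite inE mem_cat map_f ?orbT //= => /(_ isT Xx).
    by rewrite !eqseq_cons eqxx (negbTE ij) orbF /= => /eqP E; rewrite E (negbTE (geo_notin g1)) in xp.
  apply/seesP_rev; rewrite -suv; exists p2 => // x xp; apply/negP=> Xx.
  have := fr (j :: x); rewrite inE mem_cat [_ \in map (cons j) _]map_f ?orbT //; last first.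
    exact: mem_belast.
  move=> /(_ isT Xx); rewrite !eqseq_cons eqxx [j == i]eq_sym (negbTE ij) /= => /eqP E.
  by have := geo_notin (geo_rev g2); rewrite mem_rev -E xp.
apply/orP; right; rewrite le /=; apply/and3P; split.
- apply/seesP; exists p1 => // x xp; apply/negP=> Xx.
  have := fr (i :: x); rewrite inE mem_cat map_f ?orbT //= => /(_ isT Xx).
  by rewrite !eqseq_cons eqxx (negbTE ij) orbF /= => /eqP E; rewrite E (negbTE (geo_notin g1)) in xp.
- apply/seesP_rev; rewrite -suv; exists p3 => // x xp; apply/negP=> Xx.
  have := fr (j :: x); rewrite inE !mem_cat [_ \in map (cons j) _]map_f ?orbT //; last first.
    by apply: mem_belast.
  move=> /(_ isT Xx); rewrite !eqseq_cons eqxx [j == i]eq_sym (negbTE ij) /= => /eqP E.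
  by have := geo_notin (geo_rev g3); rewrite mem_rev -E xp.
have frk x : x \in nseq (size u) i :: p2 -> ~~ slice X k x.
  move=> xp; apply/negP=> Xx.
  have := fr (k :: x); rewrite inE !mem_cat [_ \in map (cons k) _]map_f ?orbT // => /(_ isT Xx).
  by rewrite !eqseq_cons ![k == _]eq_sym (negbTE ik) (negbTE jk).
rewrite sidefree_sees // frk ?mem_head //=; apply/seesP; rewrite size_nseq.
by exists p2 => // x xp; apply: frk; rewrite inE xp orbT.
Qed.

(** * Words and vertices *)

Section Transfer.
Variable n : nat.
Implicit Types (u v : SV 3 n) (X : {set SV 3 n}).

Definition code u : word := [seq u t | t <- enum 'I_n].
Definition decode (w : word) : SV 3 n := [ffun t : 'I_n => nth o0 w t].
(** The length test matters because [decode] truncates or pads words of other lengths. *)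
Definition wset X : pred word := fun w => (size w == n) && (decode w \in X).

Lemma size_code u : size (code u) = n.
Proof. by rewrite size_map size_enum_ord. Qed.

Lemma nth_code u (t : 'I_n) : nth o0 (code u) t = u t.
Proof. by rewrite (nth_map t) ?size_enum_ord // nth_ord_enum. Qed.

Lemma codeK : cancel code decode.
Proof. by move=> u; apply/ffunP=> t; rewrite ffunE nth_code. Qed.

Lemma decodeK w : size w = n -> code (decode w) = w.
Proof.
move=> sw; apply: (@eq_from_nth _ o0); rewrite size_code // => t tn.
by rewrite (nth_code _ (Ordinal tn)) ffunE.
Qed.

Lemma wset_code X u : wset X (code u) = (u \in X).
Proof. by rewrite /wset size_code eqxx codeK. Qed.

Lemma card_cnt X : #|X| = cnt n (wset X).
Proof.
rewrite cardE -(size_map code) /cnt -size_filter; apply/perm_size/uniq_perm.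
- by rewrite map_inj_uniq ?enum_uniq //; apply: can_inj codeK.
- by rewrite filter_uniq ?words_uniq.
move=> w; rewrite mem_filter mem_words; apply/mapP/andP.
  by case=> u; rewrite mem_enum => uX ->; rewrite wset_code size_code.
case=> Xw /eqP sw; exists (decode w); last by rewrite decodeK.
by case/andP: Xw; rewrite mem_enum.
Qed.

Lemma sadjE u v : sadj u v = adj (code u) (code v).
Proof.
apply/existsP/adjP; rewrite ?size_code //.
  case=> h /andP[ne /forallP nb]; exists h; rewrite ?size_code //.
  rewrite !nth_code; split=> // t tn; have /andP[h1 h2] := nb (Ordinal tn).
  rewrite -[t]/(val (Ordinal tn)) !nth_code; split=> lt.
    by have /eqP := implyP h1 lt.
  by have /andP[/eqP ? /eqP ?] := implyP h2 lt.
case=> h hn [ne nb]; exists (Ordinal hn); rewrite -!nth_code ne.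
apply/forallP => t; have [h1 h2] := nb t (ltn_ord t).
apply/andP; split; apply/implyP => lt; rewrite -!nth_code.
  by rewrite h1.
by have [-> ->] := h2 lt; rewrite !eqxx.
Qed.

Lemma path_code u p : path adj (code u) (map code p) = path (@sadj 3 n) u p.
Proof. by rewrite path_map; apply: eq_path => x y; rewrite /= sadjE. Qed.

Lemma walk_code u p v : walk (@sadj 3 n) u p v =
  path adj (code u) (map code p) && (last (code u) (map code p) == code v).
Proof. by rewrite /walk path_code last_map (can_eq codeK). Qed.

Lemma geo_code x p u : geo (code u) p x -> map code (map decode p) = p.
Proof.
case/and3P=> up _ _; rewrite -map_comp -[RHS]map_id; apply/eq_in_map => w wp /=.
by rewrite decodeK // (path_size up wp) size_code.
Qed.

(** With no obstacles the recursive test always succeeds, and [visP] turns this into a geodesic. *)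
Lemma geo_exists (x y : word) : size x = size y -> exists p, geo x p y.
Proof.
move=> sxy; suff /(visP _ sxy)[p g _] : vis pred0 x y by exists p.
have fr m i c : sidefree m pred0 i c by elim: m => //= m IH; rewrite !IH.
have se w c : sees pred0 w c.
  by elim: w => //= i w IH; rewrite [sees _ _ _]IH [sidefree _ _ _ _]fr orbT.
elim: x y sxy => [|i x IH] [|j y] //= [sxy]; case: eqP => _; first exact: IH.
by rewrite [sidefree _ _ _ _]fr ![sees _ _ _]se !andbT leq_total.
Qed.

Lemma shortest_geo u p v :
  shortest_path (@sadj 3 n) u p v <-> geo (code u) (map code p) (code v).
Proof.
have suv : size (code u) = size (code v) by rewrite !size_code.
rewrite /shortest_path /geo walk_code size_map; split.
  case=> /andP[up e] min; rewrite up e /= eqn_leq.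
  have -> : dist (code u) (code v) <= size p.
    by rewrite -(size_map code); apply: dist_le_path up (eqP e).
  have [q g] := geo_exists suv; have Eq := geo_code g.
  case/and3P: g => uq eq /eqP <-; rewrite andbT -Eq size_map; apply: min.
  by rewrite walk_code Eq uq.
case/and3P=> up e /eqP->; rewrite up e; split=> // q.
by rewrite walk_code => /andP[uq /eqP eq]; rewrite -(size_map code); apply: dist_le_path.
Qed.

Lemma visible_vis X u v :
  visible (@sadj 3 n) X u v <-> vis (wset X) (code u) (code v).
Proof.
have suv : size (code u) = size (code v) by rewrite !size_code.
split=> [[p [/shortest_geo g fr]]|/(visP _ suv)[p g fr]].
  apply/(visP _ suv); exists (map code p) => // x.
  rewrite -map_cons => /mapP[y yp ->]; rewrite wset_code !(can_eq codeK).
  exact: fr.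
exists (map decode p); rewrite (shortest_geo u _ v) (geo_code g); split=> // x xp xX.
rewrite -!(can_eq codeK); apply: fr; rewrite ?wset_code // -(geo_code g) -map_cons.
exact: map_f.
Qed.

Lemma mutual_mutvis X : mutual_visibility_set (@sadj 3 n) X <-> mutvis n (wset X).
Proof.
split=> [mX|/all_inP mX u v uX vX].
  apply/all_inP=> x sx /andP[_ xX]; apply/all_inP=> y sy /andP[_ yX].
  by rewrite -(decodeK sx) -(decodeK sy); apply/visible_vis; apply: mX.
by apply/visible_vis; apply: (all_inP _ _ _ (mX _ _ _)); rewrite ?size_code ?wset_code.
Qed.

Lemma mutvis_attained (Y : pred word) : mutvis n Y ->
  exists X : {set SV 3 n}, mutual_visibility_set (@sadj 3 n) X /\ #|X| = cnt n Y.
Proof.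
move=> mY; exists [set u | Y (code u)].
have E w : size w = n -> wset [set u | Y (code u)] w = Y w.
  by move=> sw; rewrite /wset inE decodeK // sw eqxx.
split.
  by apply/mutual_mutvis; apply: mutvis_subpred mY => w /andP[/eqP sw]; rewrite inE decodeK.
by rewrite card_cnt; apply: eq_in_count => w; rewrite mem_words => /eqP /E.
Qed.

End Transfer.

(** * Blocks as vertex sets and the theorem *)

Lemma mem_block_decode n i l (w : word) : (decode n.+1 (l :: w) \in block n.+1 i) = (l == i).
Proof.
rewrite inE; apply/existsP/idP => [[h /andP[/eqP h0]]|/eqP->].
  by rewrite ffunE h0.
by exists ord0; rewrite ffunE /= eqxx.
Qed.

Lemma card_block n (X : {set SV 3 n.+1}) i :
  #|X :&: block n.+1 i| = cnt n (slice (wset X) i).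
Proof.
have [j [k d]] := ex_distinct3 i; have [ij ik _] := and3P d.
rewrite card_cnt (cntS _ _ d).
have E l : cnt n (slice (wset (X :&: block n.+1 i)) l) = if l == i then cnt n (slice (wset X) i) else 0.
  have [->|li] := eqVneq l i.
    by apply: eq_count => w; rewrite /slice /wset inE mem_block_decode eqxx andbT.
  rewrite /cnt; apply/eqP; rewrite -leqn0 leqNgt -has_count; apply/hasPn => w _.
  by rewrite /slice /wset inE mem_block_decode (negbTE li) !andbF.
by rewrite !E eqxx ![_ == i]eq_sym (negbTE ij) (negbTE ik) !addn0.
Qed.

Theorem theorem4p4 :
  (forall n : nat, 2 <= n -> is_mu (@sadj 3 n) (3 ^ (n - 2) + 3)) /\
  (forall n : nat, 4 <= n ->
     (forall X : {set SV 3 n}, mutual_visibility_set (@sadj 3 n) X ->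
        #|X| = 3 ^ (n - 2) + 3 ->
        forall i : 'I_3, #|X :&: block n i| = 3 ^ (n - 3) + 1) /\
     (forall X : {set SV 3 n}, mutual_visibility_set (@sadj 3 n) X ->
        forall i j : 'I_3, i != j ->
        #|X :&: (block n i :|: block n j)| <= 2 * 3 ^ (n - 3) + 4)).
Proof.
split=> [[|[|n]] // _|[|[|[|[|n]]]] // _].
  rewrite !subSS subn0; split=> [|X /mutual_mutvis mX].
    (* [Xset] starts at length 3, so length 2 has its own example. *)
    case: n => [|n].
      by have [X [mX cX]] := mutvis_attained Xset2_mutvis; exists X; rewrite cX Xset2_cnt.
    by have [X [mX cX]] := mutvis_attained (Xset_mutvis n); exists X; rewrite cX Xset_cnt.
  by rewrite card_cnt; exact: (bMU (bounds_all n) mX).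
rewrite !subSS !subn0; split=> [X /mutual_mutvis mX cX i|X /mutual_mutvis mX i j ij].
  by rewrite card_block; apply: equality_blocks mX _ i; rewrite -card_cnt.
rewrite setIUr; apply: leq_trans (leq_card_setU _ _) _.
by rewrite !card_block; apply: pairs_bound mX ij.
Qed.
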